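(* Let $\boldsymbol a(\lambda)=\sum_{\ell=-d_2}^{d_1}a_\ell\lambda^\ell$ be a Laurent polynomial, let $T(\boldsymbol a)$ denote the Toeplitz operator on $L^2(\mathbb N)$ with symbol $\boldsymbol a$, and let $T_N(\boldsymbol a)$ be its natural $N$-dimensional truncation. Let $\Delta_N=N^{-\gamma}E_N$ for some $\gamma>\frac12$, where the entries of the $N\times N$ random matrix $E_N$ are independent (real or complex-valued) with zero mean and unit variance. Let $L_N$ be the empirical measure of the eigenvalues of $T_N(\boldsymbol a)+\Delta_N$. Fix $\varepsilon>0$. Then $$\mathbb P\Big(L_N\big(((\operatorname{spec}T(\boldsymbol a))^c)^{-\varepsilon}\big)=0\Big)\to1\qquad\text{as }N\to\infty .$$
   Context: Here $d_1\ge 1$, $d_2\ge 0$ are integers, $a_\ell\in\mathbb C$, and $a_{d_1}\neq0$. The operator $T(\boldsymbol a)$ acts on $L^2(\mathbb N)$ (square-summable sequences $(x_1,x_2,\dots)$) by $(T(\boldsymbol a)x)_i=\sum_{\ell=-d_2}^{d_1}a_\ell x_{i+\ell}$, with $x_m:=0$ for $m\le0$; $\operatorname{spec}T(\boldsymbol a)$ is its spectrum. $T_N(\boldsymbol a)$ is the $N\times N$ matrix with $(i,j)$ entry $a_{j-i}$ if $-d_2\le j-i\le d_1$ and $0$ otherwise. The empirical measure of eigenvalues $\lambda_1,\dots,\lambda_N$ is $L_N=N^{-1}\sum_{i=1}^N\delta_{\lambda_i}$. For $D\subset\mathbb C$ and $\varepsilon>0$, $D^{\varepsilon}:=\{z\in\mathbb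 C:\inf_{z'\in D}|z-z'|\le\varepsilon\}$ and $D^{-\varepsilon}:=((D^c)^{\varepsilon})^c$. Unit variance means $\mathbb E|e|^2=1$ for a centered entry $e$. *)

(* Defs.v *)
From HB Require Import structures.
From mathcomp Require Import all_boot all_order all_algebra.
From mathcomp Require Import complex.
From mathcomp Require Import all_classical all_reals all_analysis.

Set Implicit Arguments.
Unset Strict Implicit.
Unset Printing Implicit Defensive.

Import Order.TTheory GRing.Theory Num.Theory.
Import numFieldNormedType.Exports.

Local Open Scope classical_set_scope.
Local Open Scope complex_scope.
Local Open Scope ring_scope.

Notation modulus := Normc.normc.

Section Sequences.
Context {R : realType}.
Implicit Types (x y : nat -> R[i]) (S : (nat -> R[i]) -> nat -> R[i]).

(* Sequences are indexed from 0, so that [x k] is the entry x_(k+1) of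
   (x_1, x_2, ...). *)
Definition l2norm x : \bar R :=
  'N[counting]_(2%:E) [EFin \o (@modulus R \o x)]%E.

Definition l2 : set (nat -> R[i]) := [set x | (l2norm x < +oo)%E].

(* Only the restriction of [S] to [l2] matters in the next definitions. *)
Definition l2_bounded_linear S : Prop :=
  [/\ forall x, l2 x -> l2 (S x),
      forall (c : R[i]) x y, l2 x -> l2 y ->
        S (fun k => c * x k + y k) = (fun k => c * S x k + S y k)
    & exists M : R, forall x, l2 x -> (l2norm (S x) <= M%:E * l2norm x)%E].

Definition l2_invertible S : Prop :=
  exists2 V, l2_bounded_linear V &
    forall x, l2 x -> V (S x) = x /\ S (V x) = x.

Definition l2_spectrum S : set R[i] :=
  [set z | ~ l2_invertible (fun x k => S x k - z * x k)].

(* extension of [x] by 0 to the negative indices *)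
Definition ext0 x (m : int) : R[i] := if m is Posz k then x k else 0.

(* The coefficients of the symbol are a_l for -d2 <= l <= d1; the values of [a]
   outside this range are never used. Below, l is written k - d2. *)
Definition toeplitz_op (d1 d2 : nat) (a : int -> R[i]) x : nat -> R[i] :=
  fun i => \sum_(k < (d1 + d2).+1)
    a (k%:Z - d2%:Z) * ext0 x (i%:Z + (k%:Z - d2%:Z)).

Definition toeplitz_mx (d1 d2 : nat) (a : int -> R[i]) (N : nat) : 'M[R[i]]_N :=
  \matrix_(i < N, j < N)
    if (- d2%:Z <= j%:Z - i%:Z <= d1%:Z) then a (j%:Z - i%:Z) else 0.

End Sequences.

Section EmpiricalMeasure.
Context {R : realType} {N : nat}.

(* eigenvalues listed with algebraic multiplicity, in an unspecified order *)
Definition eigenvalues (A : 'M[R[i]]_N) : seq R[i] :=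
  sval (closed_field_poly_normal (char_poly A)).

Definition empirical_measure (A : 'M[R[i]]_N) (D : set R[i]) : R :=
  N%:R^-1 * \sum_(l <- eigenvalues A) \1_D l.

End EmpiricalMeasure.

Section Neighbourhoods.
Context {R : realType}.

(* The infimum is taken in the extended reals, where inf set0 = +oo. *)
Definition fatten (D : set R[i]) (eps : R) : set R[i] :=
  [set z | (ereal_inf [set (modulus (z - z'))%:E | z' in D] <= eps%:E)%E].

Definition shrink (D : set R[i]) (eps : R) : set R[i] := ~` fatten (~` D) eps.

End Neighbourhoods.

Section RandomVariables.
Context {R : realType} {d : measure_display} {T : measurableType d}.
Variable P : probability T R.

(* The Borel structure of the complex plane is that of [R * R]. *)
Definition re_im (z : R[i]) : R * R := (complex.Re z, complex.Im z).

Definition complex_rv (X : T -> R[i]) : Prop :=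
  measurable_fun [set: T] (re_im \o X).

Definition mutually_independent (I : finType) (X : I -> T -> R[i]) : Prop :=
  forall (J : {set I}) (B : I -> set (R * R)),
    (forall i, measurable (B i)) ->
    P (\bigcap_(i in [set` J]) ((re_im \o X i) @^-1` B i)) =
    (\prod_(i in J) P ((re_im \o X i) @^-1` B i))%E.

Definition centered (X : T -> R[i]) : Prop :=
  ('E_P[@complex.Re R \o X] = 0 /\ 'E_P[@complex.Im R \o X] = 0)%E.

(* This is the variance of [X] only if [X] is centered. *)
Definition unit_second_moment (X : T -> R[i]) : Prop :=
  ('E_P[fun w => (modulus (X w) ^+ 2)%R] = 1)%E.

Definition random_matrix_hyp (N : nat) (E : T -> 'M[R[i]]_N) : Prop :=
  let entry (ij : 'I_N * 'I_N) w := E w ij.1 ij.2 in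
  [/\ forall ij, complex_rv (entry ij),
      mutually_independent entry,
      forall ij, centered (entry ij)
    & forall ij, unit_second_moment (entry ij)].

End RandomVariables.

(* Main.v *)
Require Import Defs.
From HB Require Import structures.
From mathcomp Require Import all_boot all_order all_algebra.
From mathcomp Require Import complex.
From mathcomp Require Import all_classical all_reals all_analysis.
From mathcomp Require Import all_fingroup spectral cyclic separable cyclotomic.
From mathcomp Require Import finmap measurable_realfun ring lra zify.

Set Implicit Arguments.
Unset Strict Implicit.
Unset Printing Implicit Defensive.

Import Order.TTheory GRing.Theory Num.Theory.
Import numFieldNormedType.Exports.

Local Open Scope classical_set_scope.
Local Open Scope complex_scope.
Local Open Scope ring_scope.

(** Write T_N for the Toeplitz matrix, Delta = N^(-gamma) E for the noise and
    M = T_N - z, and suppose that z is not in the spectrum of T. The point is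
    that det(M + Delta) / det M = det(1 + Delta B), with B = M^-1, is close to 1
    in mean square. A bound on the operator norm of Delta would not do: under a
    second moment assumption this norm need not be small. The determinant is
    more forgiving, because it is affine in each entry of Delta. It expands into
    products of distinct entries, which are orthogonal in L^2, so its second
    moment is exactly the sum of the squared coefficients. Those coefficients
    are minors of B; for a fixed set of k rows of Delta their squares add up to
    k! times a Gram determinant of k columns of B, hence to at most k! K^k when
    every column of B has squared norm at most K. There are C(N, k) sets of
    rows, and altogether
      E |det(1 + Delta B) - 1|^2 <= sum_(k >= 1) (K N^(1 - 2 gamma))^k,
    which tends to 0 since gamma > 1/2 ([mean_msq_det]).

    This needs K to be independent of N, that is, stability of the finite
    sections of an invertible banded Toeplitz operator
    ([toeplitz_op_stable]). Boundedness of the inverse makes the operator, and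
    by duality its transpose, bounded below on finitely supported sequences. Cut
    a vector of length N by a linear ramp: the banded operator commutes with the
    ramp up to O(1/N), and the part which vanishes at the right end does not see
    the truncation. The complementary part is treated in the same way after
    reversing the order of the coordinates, which transposes the operator.

    To control all z in a disc at once, parametrize the disc by |u| <= 1. Both
    p = det(M + Delta) and q = det M are polynomials in u, and q has no zero in
    the closed unit disc, so some polynomial s makes q s close to 1 there. The
    values of (p - q) s in the half disc are controlled by its average modulus
    over roots of unity of large order, so a zero of p in the half disc forces
    the average of |p/q - 1|^2 over these nodes to be at least 1/36
    ([root_forces_large_average]); by Markov's inequality this is unlikely. The
    number of nodes depends on q and on a bound for the degrees, not on the
    random p. The substitution z = r/u brings a neighbourhood of infinity to the
    same form ([disc_event] covers both cases), and compactness leaves finitely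
    many discs ([controlled_outside]).

    Finally, the event of the theorem is measurable, because it has a countable
    description by lower bounds of |det(T_N + Delta - z)| at points z with
    rational coordinates ([no_eigenvalueP]), so that its probability can be
    compared with that of the exceptional events. *)

(** * Squared moduli of complex numbers *)

Section Msq.
Context {R : realType}.
Implicit Types x y z : R[i].

Definition msq z : R := modulus z ^+ 2.

Lemma msqE z : msq z = complex.Re z ^+ 2 + complex.Im z ^+ 2.
Proof. by case: z => a b /=; rewrite /msq /= sqr_sqrtr ?addr_ge0 ?sqr_ge0. Qed.

Lemma modulus_ge0 z : 0 <= modulus z.
Proof. by case: z => a b /=; exact: sqrtr_ge0. Qed.

Lemma msq_ge0 z : 0 <= msq z.
Proof. by rewrite /msq sqr_ge0. Qed.

Lemma normcC z : `|z| = (modulus z)%:C.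
Proof. by []. Qed.

Lemma msqC z : (msq z)%:C = `|z| ^+ 2.
Proof. by rewrite normcC /msq rmorphXn. Qed.

Lemma msq0 : msq 0 = 0. Proof. by rewrite msqE /= expr0n addr0. Qed.
Lemma msq1 : msq 1 = 1. Proof. by rewrite msqE /= expr0n addr0 expr1n. Qed.

Lemma msqM x y : msq (x * y) = msq x * msq y.
Proof. by rewrite /msq Normc.normcM exprMn. Qed.

Lemma msqN x : msq (- x) = msq x.
Proof. by case: x => a b; rewrite !msqE /= !sqrrN. Qed.

Lemma msqJ x : msq x^* = msq x.
Proof. by case: x => a b; rewrite !msqE /= !sqrrN. Qed.

Lemma msq_real (r : R) : msq r%:C = r ^+ 2.
Proof. by rewrite msqE /= expr0n addr0. Qed.

Lemma mulcJ x : x * x^* = (msq x)%:C.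
Proof. by rewrite msqC sqr_normc. Qed.

Lemma msqD x y : msq (x + y) <= 2 * (msq x + msq y).
Proof.
case: x y => [a b] [c d]; rewrite !msqE /=.
have := sqr_ge0 (a - c); have := sqr_ge0 (b - d); rewrite !sqrrB !sqrrD; lra.
Qed.

Lemma msq_eq0 x : (msq x == 0) = (x == 0).
Proof.
case: x => a b; rewrite msqE /= paddr_eq0 ?sqr_ge0// !sqrf_eq0 eq_complex /=.
by [].
Qed.

Lemma modulus_eq0 x : (modulus x == 0) = (x == 0).
Proof. by rewrite -msq_eq0 sqrf_eq0. Qed.

Lemma modulusD x y : modulus (x + y) <= modulus x + modulus y.
Proof. exact: le_normcD. Qed.

Lemma modulusM x y : modulus (x * y) = modulus x * modulus y.
Proof. exact: Normc.normcM. Qed.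

Lemma modulusN x : modulus (- x) = modulus x.
Proof. by case: x => a b /=; rewrite !sqrrN. Qed.

Lemma modulusX x n : modulus (x ^+ n) = modulus x ^+ n.
Proof. by elim: n => [|n IH]; rewrite ?expr0 ?Normc.normc1// !exprS modulusM IH. Qed.

Lemma modulusV x : modulus x^-1 = (modulus x)^-1.
Proof. exact: Normc.normcV. Qed.

Lemma modulus_real (r : R) : modulus r%:C = `|r|.
Proof. by rewrite /= expr0n addr0 sqrtr_sqr. Qed.

Lemma modulus_sum (I : Type) (s : seq I) (P : pred I) (F : I -> R[i]) :
  modulus (\sum_(i <- s | P i) F i) <= \sum_(i <- s | P i) modulus (F i).
Proof.
elim/big_rec2: _ => [|i y x _ IH]; first by rewrite Normc.normc0.
by rewrite (le_trans (modulusD _ _))// lerD2l.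
Qed.

Lemma modulus_prod (I : Type) (s : seq I) (P : pred I) (F : I -> R[i]) :
  modulus (\prod_(i <- s | P i) F i) = \prod_(i <- s | P i) modulus (F i).
Proof.
elim/big_rec2: _ => [|i y x _ IH]; first by rewrite Normc.normc1.
by rewrite modulusM IH.
Qed.

Lemma sqr_sum_le (n : nat) (F : 'I_n -> R) :
  (\sum_i F i) ^+ 2 <= n%:R * \sum_i F i ^+ 2.
Proof.
elim: n F => [|n IH] F; first by rewrite !big_ord0 expr0n mul0r.
rewrite !big_ord_recl; set a := F ord0; set s := \sum_(i < n) _; set q := \sum_(i < n) _.
have IH' : s ^+ 2 <= n%:R * q by exact: IH.
have q0 : 0 <= q by apply: sumr_ge0 => i _; exact: sqr_ge0.
rewrite -natr1 sqrrD mulrDl mul1r mulrDr.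
suff : a * s *+ 2 <= n%:R * a ^+ 2 + q by lra.
have [n0|n0] := posnP n.
  have -> : s = 0 by rewrite /s; apply: big1 => -[m m0]; exfalso; rewrite n0 in m0.
  by rewrite mulr0 mul0rn n0 mul0r add0r.
have nR : 0 < n%:R :> R by rewrite ltr0n.
rewrite -(ler_pM2l nR); have : 0 <= (n%:R * a - s) ^+ 2 by exact: sqr_ge0.
by nra.
Qed.

Lemma msq_sum (n : nat) (F : 'I_n -> R[i]) :
  msq (\sum_i F i) <= n%:R * \sum_i msq (F i).
Proof.
apply: le_trans (sqr_sum_le (fun i => modulus (F i))).
by rewrite lerXn2r ?nnegrE ?modulus_ge0 ?sumr_ge0 ?modulus_sum// => i _; exact: modulus_ge0.
Qed.

End Msq.

(** * Minors and Gram determinants *)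

Section Gram.
Variable C : numClosedFieldType.

Lemma conjmxK (m n : nat) (A : 'M[C]_(m, n)) :
  map_mx Num.conj (map_mx Num.conj A) = A.
Proof. by apply/matrixP => i j; rewrite !mxE; exact: conjCK. Qed.

(** A Gram matrix is unitarily diagonalizable with nonnegative eigenvalues; by
    the inequality of arithmetic and geometric means their product is at most
    the n-th power of their mean, which is the trace divided by n. *)
Lemma det_gram_le1 (m n : nat) (K : 'M[C]_(m, n)) :
  (\sum_j \sum_i `|K i j| ^+ 2 <= n%:R) -> \det ((map_mx Num.conj K)^T *m K) <= 1.
Proof.
case: n K => [|n] K; first by rewrite det_mx00.
set A := _ *m K => trK.
have AH : (map_mx Num.conj A)^T = A.
  by rewrite /A map_mxM trmx_mul !map_trmx trmxK conjmxK.
have /orthomx_spectralP AE : A \is normalmx.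
  by apply/normalmxP; rewrite -map_trmx AH.
set P := spectralmx A in AE; set d := spectral_diag A in AE.
have PU : P \is unitarymx by exact: spectral_unitarymx.
have Pinv : invmx P = (map_mx Num.conj P)^T by rewrite invmx_unitary // map_trmx.
have dE : diag_mx d = (map_mx Num.conj (K *m invmx P))^T *m (K *m invmx P).
  have -> : diag_mx d = P *m A *m invmx P.
    rewrite [in RHS]AE !mulmxA mulmxV ?unitarymx_unit// mul1mx.
    by rewrite -mulmxA mulmxV ?unitarymx_unit// mulmx1.
  rewrite /A map_mxM trmx_mul !mulmxA; congr (_ *m _ *m _ *m _).
  by rewrite Pinv !map_trmx trmxK conjmxK.
have d_ge0 i : 0 <= d 0 i.
  have -> : d 0 i = (diag_mx d) i i by rewrite mxE eqxx.
  rewrite dE mxE sumr_ge0 // => k _; rewrite !mxE mulrC -normCK.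
  exact: exprn_ge0.
have detA : \det A = \prod_i d 0 i.
  rewrite AE !det_mulmx det_diag mulrAC det_inv mulVf ?mul1r //.
  by have := unitarymx_unit PU; rewrite unitmxE unitfE.
have trA : \sum_i d 0 i = \sum_j \sum_i `|K i j| ^+ 2.
  rewrite -mxtrace_diag (_ : diag_mx d = P *m A *m invmx P); last first.
    rewrite [in RHS]AE !mulmxA mulmxV ?unitarymx_unit// mul1mx.
    by rewrite -mulmxA mulmxV ?unitarymx_unit// mulmx1.
  rewrite mxtrace_mulC mulmxA mulVmx ?unitarymx_unit// mul1mx.
  apply: eq_bigr => j _; rewrite mxE; apply: eq_bigr => i _.
  by rewrite !mxE mulrC normCK.
rewrite detA.
have dn_ge0 : {in 'I_n.+1, forall i, 0 <= d 0 i *+ #|'I_n.+1|}.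
  by move=> i _; rewrite mulrn_wge0.
have le1 := leif_le (leif_AGM_scaled dn_ge0).
rewrite prodrMn_const card_ord trA in le1.
have : (\prod_(i in 'I_n.+1) d 0 i) * (n.+1%:R ^+ n.+1) <= n.+1%:R ^+ n.+1.
  rewrite -natrX mulr_natr natrX; apply: (le_trans le1).
  apply: lerXn2r => //; rewrite ?nnegrE ?sumr_ge0// => i _.
  by apply: sumr_ge0 => j _; exact: exprn_ge0.
by rewrite -ler_pdivlMr ?exprn_gt0 ?ltr0n// divff ?expf_neq0 ?pnatr_eq0.
Qed.

Section SumMinors.
Variables (N : nat) (B : 'M[C]_N).
Implicit Types (h : {ffun 'I_N -> option 'I_N}) (S : {set 'I_N}).

(** A partial map [h] replaces row i of the identity by row [h i] of [B], where
    it is defined. Up to sign, the determinant is the minor of [B] with columns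
    [supp h] and rows [h]. *)
Definition select_rows h : 'M[C]_N :=
  \matrix_(i, j) if h i is Some k then B k j else (i == j)%:R.

Definition supp h : {set 'I_N} := [set i | h i != None].

Lemma perm_onNP S (s : {perm 'I_N}) :
  ~~ perm_on S s -> exists2 i, i \notin S & s i != i.
Proof.
move=> sS; have [i /andP[iS si]|H] := pickP (fun i => (i \notin S) && (s i != i)).
  by exists i.
case/negP: sS; apply/fintype.subsetP => i; rewrite inE => si.
by have := H i; rewrite si andbT => /negbFE.
Qed.

(** The rows in [S] are those of the Gram matrix of the columns of [B], the
    others those of the identity. Keeping the size N avoids any reindexing of
    [S]; the determinant is that of the block indexed by [S]. *)
Let gram S : 'M[C]_N := \matrix_(i, j)
  if i \in S then \sum_k (B k i)^* * B k j else (i == j)%:R.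

(** Its Gram matrix is block diagonal, with the Gram matrix of the columns of
    [B] in [S] and an identity block; so its trace is under control. *)
Let mask S : 'M[C]_(N + N, N) := col_mx
  (\matrix_(i, j) if j \in S then B i j else 0)
  (\matrix_(i, j) if j \in S then 0 else (i == j)%:R).

(** In the Leibniz formula, only the permutations supported in [S] contribute
    to the determinant of a matrix whose rows outside [S] are those of the
    identity. *)
Lemma prod_notperm_on S (M : 'M[C]_N) (s : {perm 'I_N}) :
  (forall i j, i \notin S -> M i j = (i == j)%:R) ->
  ~~ perm_on S s -> \prod_i M i (s i) = 0.
Proof.
move=> ME /perm_onNP[i iS si]; apply/eqP/prodf_eq0; exists i => //.
by rewrite ME// [i == _]eq_sym (negPf si).
Qed.

Lemma det_gram_mask S : \det (gram S) = \det ((map_mx Num.conj (mask S))^T *m mask S).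
Proof.
have maskE i j : ((map_mx Num.conj (mask S))^T *m mask S) i j =
    if i \in S then if j \in S then gram S i j else 0 else (i == j)%:R.
  rewrite mxE big_split_ord /=.
  under eq_bigr do rewrite 2!mxE !col_mxEu 2!mxE.
  under [X in _ + X]eq_bigr do rewrite 2!mxE !col_mxEd 2!mxE.
  rewrite mxE; case: (boolP (i \in S)) => iS; case: (boolP (j \in S)) => jS.
  - rewrite [X in _ + X]big1 ?addr0// => k _.
    by rewrite conjC0 mul0r.
  - by rewrite !big1 ?addr0// => k _; rewrite ?conjC0 (mulr0, mul0r).
  - rewrite !big1 => [|k _|k _]; rewrite ?conjC0 ?(mulr0, mul0r, addr0)//.
    by case: eqP => // ij; rewrite -ij (negPf iS) in jS.
  - rewrite big1 ?add0r; last by move=> k _; rewrite mulr0.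
    rewrite (bigD1 i)//= eqxx conjC1 mul1r big1 ?addr0// => k ki.
    by rewrite (negPf ki) conjC0 mul0r.
apply: eq_bigr => s _; congr (_ * _).
have [sS|sS] := boolP (perm_on S s).
  apply: eq_bigr => i _; rewrite maskE (perm_closed _ sS) [LHS]mxE.
  by rewrite [gram S i _]mxE; case: (i \in S).
rewrite !(@prod_notperm_on S)// => i j iS; first by rewrite maskE (negPf iS).
by rewrite mxE (negPf iS).
Qed.

(** Multilinearity in the rows: each row in [S] is a combination of the rows of
    [B], and the coefficient conj(B k i) of row k is the conjugate of a diagonal
    entry of [select_rows h]. *)
Lemma det_gramE S : \det (gram S) =
  \sum_(h | supp h == S)
     (\prod_i (select_rows h i i)^*) * \det (select_rows h).
Proof.
transitivity (\sum_(s : {perm 'I_N}) \sum_(h | supp h == S)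
    (-1) ^+ s * \prod_i ((select_rows h i i)^* * select_rows h i (s i))).
  apply: eq_bigr => s _; rewrite -big_distrr /=; congr (_ * _).
  pose Q i : {pred option 'I_N} := fun o => (i \in S) == (o != None).
  pose F i (o : option 'I_N) : C := if o is Some k then (B k i)^* * B k (s i)
    else (i == s i)%:R.
  transitivity (\prod_i \sum_(o | Q i o) F i o).
    apply: eq_bigr => i _; rewrite mxE /Q; case: (i \in S) => /=.
      rewrite (reindex_omap Some id)/=; last by case.
      by apply: eq_bigl => k; rewrite eqxx.
    rewrite (big_pred1 None)//; by case.
  rewrite bigA_distr_big_dep /=; apply: eq_big => [h|h _].
    apply/familyP/eqP => [hQ|hS i].
      by apply/setP => i; have := hQ i; rewrite inE /Q unfold_in => /eqP <-.
    by rewrite unfold_in -hS inE.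
  apply: eq_bigr => i _; rewrite /F !mxE; case: (h i) => //=.
  by rewrite eqxx rmorph1 mul1r.
rewrite exchange_big /=; apply: eq_bigr => h _; rewrite big_distrr /=.
by apply: eq_bigr => s _; rewrite big_split mulrCA.
Qed.

(** Cauchy-Binet, with the rows listed in every order. Averaging [det_gramE]
    over the permutations of [S] turns the product of the diagonal entries into
    the conjugate of the determinant, by antisymmetry. *)
Lemma sum_sqr_det_select_rows S :
  \sum_(h | supp h == S) `|\det (select_rows h)| ^+ 2 =
  (#|S|)`!%:R * \det (gram S).
Proof.
pose act (s : {perm 'I_N}) h : {ffun 'I_N -> option 'I_N} := [ffun i => h (s i)].
have actK s : cancel (act s) (act s^-1%g).
  by move=> h; apply/ffunP => i; rewrite !ffunE permKV.
have supp_act s h : perm_on S s -> (supp (act s h) == S) = (supp h == S).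
  move=> sS; apply/eqP/eqP => /setP hS; apply/setP => i.
    have := hS (s^-1%g i); rewrite !inE ffunE permKV => ->.
    by rewrite (perm_closed _ (perm_onV sS)).
  by have := hS (s i); rewrite !inE ffunE => ->; rewrite (perm_closed _ sS).
have select_act s h : perm_on S s -> supp h = S ->
    select_rows (act s h) = row_perm s (select_rows h).
  move=> sS hS; apply/matrixP => i j; rewrite !mxE ffunE.
  case E: (h (s i)) => [k|] //.
  have : s i \notin S by rewrite -hS inE E.
  by rewrite (perm_closed _ sS) => /(out_perm sS) ->.
rewrite mulr_natl -card_perm -sum1_card -sumrMnr.
transitivity (\sum_(s : {perm 'I_N} | perm_on S s) \sum_(h | supp h == S)
   (\prod_i (select_rows h (s i) i)^*) * ((-1) ^+ s * \det (select_rows h))).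
  rewrite exchange_big /=; apply: eq_bigr => h /eqP hS.
  under eq_bigr do rewrite mulrA.
  rewrite -big_distrl /= normCKC; congr (_ * _).
  rewrite -det_tr rmorph_sum [LHS](bigID (perm_on S))/= [X in _ + X]big1 ?addr0 => [|s sS].
    apply: eq_bigr => s sS; rewrite rmorphM rmorph_sign mulrC rmorph_prod.
    by congr (_ * _); apply: eq_bigr => i _; rewrite mxE.
  suff -> : \prod_i (select_rows h)^T i (s i) = 0 by rewrite mulr0 rmorph0.
  rewrite (reindex_inj (@perm_inj _ s^-1%g)) /=.
  under eq_bigr do rewrite permKV mxE.
  apply: (@prod_notperm_on S); last by apply: contra sS => /perm_onV; rewrite invgK.
  by move=> i j; rewrite -hS inE negbK mxE => /eqP ->.
apply: eq_big => // s sS.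
rewrite det_gramE mulr1n [RHS](reindex (act s)); last first.
  apply: onW_bij; exists (act s^-1%g) => [|h]; first exact: actK.
  by apply/ffunP => i; rewrite !ffunE permK.
apply: eq_big => [h|h /eqP hS]; first by rewrite supp_act.
rewrite select_act// row_permE det_mulmx det_perm.
by congr (_ * _); apply: eq_bigr => i _; rewrite -row_permE [row_perm _ _ i i]mxE.
Qed.

Lemma sum_sqr_det_select_rows_le S :
  (forall j, \sum_i `|B i j| ^+ 2 <= 1) ->
  \sum_(h | supp h == S) `|\det (select_rows h)| ^+ 2 <= (#|S|)`!%:R.
Proof.
move=> Ble1; rewrite sum_sqr_det_select_rows ler_piMr// det_gram_mask.
apply: det_gram_le1; apply: (@le_trans _ _ (\sum_(j < N) 1)); last first.
  by rewrite sumr_const card_ord.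
apply: ler_sum => j _; rewrite big_split_ord /=.
under eq_bigr do rewrite col_mxEu mxE.
under [X in _ + X]eq_bigr do rewrite col_mxEd mxE.
case: (j \in S).
  by rewrite [X in _ + X]big1 ?addr0// => i _; rewrite normr0 expr0n.
rewrite big1 ?add0r => [|i _]; last by rewrite normr0 expr0n.
rewrite (bigD1 j)//= eqxx normr1 expr1n big1 ?addr0// => i ij.
by rewrite (negPf ij) normr0 expr0n.
Qed.

(** Row i of the matrix is row i of the identity plus a combination of the rows
    of [B] with coefficients [D i k]; expand in all rows. *)
Lemma det_add1_mulmx (D : 'M[C]_N) : \det (1%:M + D *m B) =
  \sum_(h : {ffun _ -> _}) (\prod_i if h i is Some k then D i k else 1) * \det (select_rows h).
Proof.
pose F (s : {perm 'I_N}) i (o : option 'I_N) : C :=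
  if o is Some k then D i k * B k (s i) else (i == s i)%:R.
transitivity (\sum_(s : {perm 'I_N}) \sum_(h : {ffun 'I_N -> option 'I_N})
    (-1) ^+ s * \prod_i F s i (h i)).
  apply: eq_bigr => s _; rewrite -big_distrr /=; congr (_ * _).
  rewrite -bigA_distr_bigA /=; apply: eq_bigr => i _.
  rewrite (bigD1 None)//= 3!mxE (reindex_omap Some id)/=; last by case.
  by congr (_ + _); apply: eq_bigl => k; rewrite eqxx.
rewrite exchange_big /=; apply: eq_bigr => h _; rewrite big_distrr /=.
apply: eq_bigr => s _; rewrite mulrCA -big_split; congr (_ * _).
apply: eq_bigr => i _; rewrite /F mxE; case: (h i) => //=.
by rewrite mul1r.
Qed.

End SumMinors.

End Gram.

(** * Expectation of a product of independent variables *)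

Section IndependentProducts.
Context {R : realType} {d : measure_display} {T : measurableType d}.
Variable P : probability T R.

Import HBNNSimple.

(** Independence from the event [Y \in B], for all measurable [B], passes to
    simple functions of [Y] by linearity and to nonnegative ones by monotone
    convergence. *)
Lemma integral_mul_indep d' (U : measurableType d') (Y : T -> U) (G : T -> R) (f : U -> R) :
  measurable_fun [set: T] Y -> measurable_fun [set: T] G ->
  (forall w, 0 <= G w) -> (\int[P]_w (G w)%:E)%E \is a fin_num ->
  (forall B, measurable B -> \int[P]_w (\1_B (Y w) * G w)%:E =
     \int[P]_w (\1_B (Y w))%:E * \int[P]_w (G w)%:E)%E ->
  measurable_fun [set: U] f -> (forall y, 0 <= f y) ->
  (\int[P]_w (f (Y w) * G w)%:E =
   \int[P]_w (f (Y w))%:E * \int[P]_w (G w)%:E)%E.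
Proof.
move=> mY mG G0 Gfin indepB mf f0.
have mF : measurable_fun [set: U] (EFin \o f) by exact/measurable_EFinP.
pose s := nnsfun_approx (@measurableT _ U) mF.
have mindic (B : set U) : measurable B ->
    measurable_fun [set: T] (fun w => \1_B (Y w) : R).
  move=> mB; apply: (measurableT_comp _ mY).
  by apply: measurable_indic.
have step n : (\int[P]_w (s n (Y w) * G w)%:E =
    \int[P]_w (s n (Y w))%:E * \int[P]_w (G w)%:E)%E.
  set vs := fset_set (s n @` setT).
  have v0 (i : 'I_#|` vs|) : 0 <= vs`_i.
    have : vs`_i \in vs by rewrite mem_nth.
    by rewrite in_fset_set => [/set_mem[x _ <-]|]; [|exact: fimfunP].
  have mB (i : 'I_#|` vs|) : measurable (s n @^-1` [set vs`_i]) by [].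
  under eq_integral do rewrite fimfunEord mulr_suml -sumEFin.
  under [in RHS]eq_integral do rewrite fimfunEord -sumEFin.
  rewrite ge0_integral_sum//; last 2 first.
  - move=> i; apply/measurable_EFinP/measurable_funM => //.
    by apply: measurable_funM => //; exact: mindic.
  - by move=> i w _; rewrite lee_fin !mulr_ge0// indicE.
  rewrite ge0_integral_sum//; last 2 first.
  - by move=> i; apply/measurable_EFinP/measurable_funM => //; exact: mindic.
  - by move=> i w _; rewrite lee_fin !mulr_ge0// indicE.
  rewrite ge0_sume_distrl; last first.
    by move=> i _; apply: integral_ge0 => w _; rewrite lee_fin mulr_ge0// indicE.
  apply: eq_bigr => i _.
  under eq_integral do rewrite -mulrA EFinM.
  under [in RHS]eq_integral do rewrite EFinM.
  rewrite ge0_integralZl_EFin//; last 2 first.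
  - by move=> w _; rewrite lee_fin mulr_ge0// indicE.
  - by apply/measurable_EFinP/measurable_funM => //; exact: mindic.
  rewrite ge0_integralZl_EFin//; last first.
    by apply/measurable_EFinP; exact: mindic.
  by rewrite indepB// muleA.
have scvg y : s n y @[n --> \oo] --> f y.
  apply: (@fine_cvg _ _ _ _ (fun n => (s n y)%:E)).
  exact: (@cvg_nnsfun_approx _ _ _ _ _ (EFin \o f) mF (fun x _ => f0 x)).
have snd y : {homo (fun n => s n y) : m n / (m <= n)%N >-> m <= n}.
  by move=> m n mn; exact/lefP/nd_nnsfun_approx.
have ms n : measurable_fun [set: T] (fun w => s n (Y w)).
  by apply: measurableT_comp.
have cvgl : (\int[P]_w (s n (Y w) * G w)%:E)%E @[n --> \oo] -->
    (\int[P]_w (f (Y w) * G w)%:E)%E.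
  rewrite [X in _ --> X](_ : _ = \int[P]_w limn (fun n => (s n (Y w) * G w)%:E))%E.
    apply: cvg_monotone_convergence => //.
    - by move=> n; apply/measurable_EFinP/measurable_funM.
    - by move=> n w _; rewrite lee_fin mulr_ge0.
    - by move=> w _ m n mn; rewrite lee_fin ler_wpM2r// snd.
  apply: eq_integral => w _; apply/esym/cvg_lim => //.
  by apply: cvg_EFin; [exact: nearW|apply: cvgMr_tmp; exact: scvg].
have cvgr : (\int[P]_w (s n (Y w))%:E)%E @[n --> \oo] --> (\int[P]_w (f (Y w))%:E)%E.
  rewrite [X in _ --> X](_ : _ = \int[P]_w limn (fun n => (s n (Y w))%:E))%E.
    apply: cvg_monotone_convergence => //.
    - by move=> n; apply/measurable_EFinP.
    - by move=> n w _; rewrite lee_fin.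
    - by move=> w _ m n mn; rewrite lee_fin snd.
  apply: eq_integral => w _; apply/esym/cvg_lim => //.
  by apply: cvg_EFin; [exact: nearW|exact: scvg].
apply: (cvg_unique _ cvgl) => //.
rewrite /= (_ : (fun n => _) =
    (fun n => \int[P]_w (s n (Y w))%:E * \int[P]_w (G w)%:E)%E).
  exact: cvgeZr.
by apply/funext => n; rewrite step.
Qed.

(** The definition of independence is the case of indicator functions. They are
    replaced by arbitrary functions one index at a time: the induction
    hypothesis, with an indicator function at the new index, says that the
    product of the other factors is independent of the new variable. *)
Lemma integral_prod_indep_ge0 (I : finType) (X : I -> T -> R[i])
    (f : I -> R * R -> R) :
  (forall i, complex_rv (X i)) -> mutually_independent P X ->
  (forall i, measurable_fun [set: R * R] (f i)) -> (forall i y, 0 <= f i y) ->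
  (forall i, (\int[P]_w (f i (re_im (X i w)))%:E)%E \is a fin_num) ->
  (\int[P]_w (\prod_i f i (re_im (X i w)))%:E =
   \prod_i \int[P]_w (f i (re_im (X i w)))%:E)%E.
Proof.
move=> mX indepX mf f0 ffin.
suff main (s : seq I) : forall f : I -> R * R -> R,
    (forall i, measurable_fun [set: R * R] (f i)) -> (forall i y, 0 <= f i y) ->
    (forall i, (\int[P]_w (f i (re_im (X i w)))%:E)%E \is a fin_num) ->
    (forall i, i \notin s -> exists2 B, measurable B & f i = \1_B) ->
    (\int[P]_w (\prod_i f i (re_im (X i w)))%:E =
     \prod_i \int[P]_w (f i (re_im (X i w)))%:E)%E.
  by apply: (main (enum I)) => // i; rewrite mem_enum.
have mprod (r : seq I) (Q : pred I) (g : I -> R * R -> R) :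
    (forall i, measurable_fun [set: R * R] (g i)) ->
    measurable_fun [set: T] (fun w => \prod_(i <- r | Q i) g i (re_im (X i w))).
  move=> mg; rewrite (_ : (fun w => _) =
      (fun w => \prod_(i <- [seq j <- r | Q j]) g i (re_im (X i w)))).
    by apply: measurable_prod => i _; apply: (measurableT_comp (mg i)); exact: mX.
  by apply/funext => w; rewrite big_filter.
elim: s => [|e s IH] {mf f0 ffin}f mf f0 ffin fs.
  have {fs} /choice[B HB] (i : I) : exists B : set (R * R), measurable B /\ f i = \1_B.
    by have [//|B mB fB] := fs i; exists B.
  have fE i : f i = \1_(B i) by case: (HB i).
  have mB i : measurable (B i) by case: (HB i).
  have mYB i : measurable ((re_im \o X i) @^-1` B i).
    by rewrite -[X in measurable X]setTI; exact: (mX i).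
  have := indepX [set: I]%SET B mB.
  rewrite (eq_bigl xpredT) => [|i]; last by rewrite inE.
  set A := \bigcap_(i in _) _ => PA.
  transitivity (P A).
    rewrite -[A]setIT -integral_indic//; last first.
      by apply: fin_bigcap_measurable => // i _; exact: mYB.
    apply: eq_integral => w _; congr (_%:E).
    rewrite indicE; case: (boolP (w \in A)) => wA.
      rewrite big1// => i _; rewrite fE indicE mem_set//.
      by have := set_mem wA; apply; rewrite /= finset.in_setT.
    have {}wA : ~ A w by move=> Aw; move/negP: wA; apply; exact: mem_set.
    apply/eqP; rewrite prodf_seq_eq0; apply/hasP.
    apply: contrapT => nex; apply: wA => i _ /=.
    apply: contrapT => nB; apply: nex; exists i; first by rewrite mem_index_enum.
    by rewrite /= fE indicE memNset.
  rewrite PA; apply: eq_bigr => i _.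
  have := integral_indic P measurableT (mYB i); rewrite setIT => <-.
  by apply: eq_integral => w _; rewrite fE !indicE.
have [es|es] := boolP (e \in s).
  apply: IH => // i is_; apply: fs; rewrite inE negb_or is_ andbT.
  by apply: contraNneq is_ => ->.
pose G w := \prod_(i | i != e) f i (re_im (X i w)).
pose fB (B : set (R * R)) i : R * R -> R := if i == e then \1_B else f i.
have mYe (B : set (R * R)) : measurable B -> measurable ((re_im \o X e) @^-1` B).
  by move=> mB; rewrite -[X in measurable X]setTI; exact: (mX e).
have intB (B : set (R * R)) : measurable B ->
    (\int[P]_w (\1_B (re_im (X e w)))%:E = P ((re_im \o X e) @^-1` B))%E.
  move=> mB; have := integral_indic P measurableT (mYe _ mB); rewrite setIT => <-.
  by apply: eq_integral => w _; rewrite !indicE.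
have IHB (B : set (R * R)) : measurable B ->
    (\int[P]_w (\1_B (re_im (X e w)) * G w)%:E =
     \int[P]_w (\1_B (re_im (X e w)))%:E *
       \prod_(i | i != e) \int[P]_w (f i (re_im (X i w)))%:E)%E.
  move=> mB; have fBe : fB B e = \1_B by rewrite /fB eqxx.
  have fBn i : i != e -> fB B i = f i by rewrite /fB => /negPf ->.
  transitivity (\int[P]_w (\prod_i fB B i (re_im (X i w)))%:E)%E.
    apply: eq_integral => w _; congr (_%:E); rewrite [RHS](bigD1 e)//= fBe.
    by congr (_ * _); apply: eq_bigr => i ie; rewrite fBn.
  rewrite IH.
  - rewrite (bigD1 e)//= fBe; congr (_ * _)%E.
    by apply: eq_bigr => i ie; rewrite fBn.
  - by move=> i; rewrite /fB; case: eqP => // _; exact: measurable_indic.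
  - by move=> i y; rewrite /fB; case: eqP => // _; rewrite indicE.
  - move=> i; rewrite /fB; case: eqP => [->|//].
    by rewrite intB// fin_num_measure//; exact: mYe.
  - move=> i is_; rewrite /fB; case: eqP => [_|/eqP ie]; first by exists B.
    by apply: fs; rewrite inE negb_or ie.
have intG : (\int[P]_w (G w)%:E =
     \prod_(i | i != e) \int[P]_w (f i (re_im (X i w)))%:E)%E.
  have := IHB setT measurableT; rewrite intB// preimage_setT probability_setT mul1e => <-.
  by apply: eq_integral => w _; rewrite indicE in_setT mul1r.
under eq_integral do rewrite (bigD1 e)//=.
rewrite [RHS](bigD1 e)//= -intG.
apply: (integral_mul_indep (U := (R * R)%type) (Y := re_im \o X e) (G := G)) => //.
- exact: (mX e).
- exact: mprod.
- by move=> w; apply: prodr_ge0.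
- by rewrite intG; apply: prode_fin_num.
- by move=> B mB; rewrite intG; exact: IHB.
Qed.

End IndependentProducts.

(** * Means of complex random variables *)

Section ComplexMeans.
Context {R : realType} {d : measure_display} {T : measurableType d}.
Variable P : probability T R.
Implicit Types (f g : T -> R) (Z : T -> R[i]).

(** Relations rather than operations: the existence of the integrals travels
    with their values. *)
Definition real_mean f (v : R) : Prop :=
  P.-integrable [set: T] (EFin \o f) /\ (\int[P]_w (f w)%:E)%E = v%:E.

Definition mean Z (v : R[i]) : Prop :=
  real_mean (fun w => complex.Re (Z w)) (complex.Re v) /\
  real_mean (fun w => complex.Im (Z w)) (complex.Im v).

Lemma real_meanD f g u v :
  real_mean f u -> real_mean g v -> real_mean (fun w => f w + g w) (u + v).
Proof.
move=> [fi fu] [gi gv]; split.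
  rewrite (_ : _ \o _ = (EFin \o f) \+ (EFin \o g))%E//.
  exact: integrableD.
by under eq_integral do rewrite EFinD; rewrite integralD// fu gv.
Qed.

Lemma real_meanZ f u (k : R) :
  real_mean f u -> real_mean (fun w => k * f w) (k * u).
Proof.
move=> [fi fu]; split.
  rewrite (_ : _ \o _ = (fun w => k%:E * (EFin \o f) w))%E//.
  exact: integrableZl.
by under eq_integral do rewrite EFinM; rewrite integralZl// fu.
Qed.

Lemma real_mean_le f g v : measurable_fun [set: T] f ->
  (forall w, `|f w| <= g w) -> real_mean g v -> exists u, real_mean f u.
Proof.
move=> mf fg [gi _]; have fi : P.-integrable [set: T] (EFin \o f).
  apply: le_integrable gi => //; first exact/measurable_EFinP.
  by move=> w _; rewrite /= lee_fin (le_trans (fg w))// ler_norm.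
exists (fine (\int[P]_w (f w)%:E)); split => //.
by rewrite fineK//; exact: integrable_fin_num.
Qed.

Lemma real_mean_ge0 f v : measurable_fun [set: T] f -> (forall w, 0 <= f w) ->
  (\int[P]_w (f w)%:E)%E = v%:E -> real_mean f v.
Proof.
move=> mf f0 fv; split => //; apply/integrableP; split.
  exact/measurable_EFinP.
under eq_integral => w _ do rewrite /= ger0_norm//.
by rewrite fv ltry.
Qed.

Lemma meanD Z1 Z2 u v :
  mean Z1 u -> mean Z2 v -> mean (fun w => Z1 w + Z2 w) (u + v).
Proof.
move=> [r1 i1] [r2 i2]; split; rewrite raddfD /=.
  by under [X in real_mean X]eq_fun do rewrite raddfD; exact: real_meanD.
by under [X in real_mean X]eq_fun do rewrite raddfD; exact: real_meanD.
Qed.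

Lemma meanZ Z u c : mean Z u -> mean (fun w => c * Z w) (c * u).
Proof.
case: c u => [a b] [x y] [rZ iZ]; split => /=.
  rewrite -mulNr (_ : (fun w => _) =
    (fun w => a * complex.Re (Z w) + (- b) * complex.Im (Z w))); last first.
    by apply/funext => w; case: (Z w) => p q /=; rewrite mulNr.
  by apply: real_meanD; exact: real_meanZ.
rewrite (_ : (fun w => _) =
  (fun w => a * complex.Im (Z w) + b * complex.Re (Z w))); last first.
  by apply/funext => w; case: (Z w).
by apply: real_meanD; exact: real_meanZ.
Qed.

Lemma mean_real f v : real_mean f v -> mean (fun w => (f w)%:C) v%:C.
Proof.
move=> fv; split => //=; split; last by rewrite integral0_eq.
exact: integrable0.
Qed.

Lemma mean_sum (I : Type) (s : seq I) (Q : pred I) (Z : I -> T -> R[i]) v :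
  (forall i, Q i -> mean (Z i) (v i)) ->
  mean (fun w => \sum_(i <- s | Q i) Z i w) (\sum_(i <- s | Q i) v i).
Proof.
move=> Zv; elim: s => [|i s IH].
  rewrite big_nil; under [X in mean X]eq_fun do rewrite big_nil.
  by split; split; rewrite /= ?integral0_eq//; exact: integrable0.
rewrite big_cons; under [X in mean X]eq_fun do rewrite big_cons.
by case: ifP => // Qi; apply: meanD => //; exact: Zv.
Qed.

Lemma mean_unique Z u v : mean Z u -> mean Z v -> u = v.
Proof.
case: u v => [a b] [c e] [[_ /= ra] [_ /= ib]] [[_ /= rc] [_ /= ie]].
by move: rc ie; rewrite ra ib => -[->] [->].
Qed.

End ComplexMeans.

Section Parts.
Context {R : realType}.
Implicit Types (q : 'I_4) (z : R[i]).

(** The positive part of z in the direction i^q: complex multilinear identities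
    reduce to nonnegative functions through the four of them. *)
Definition part (q : 'I_4) (z : R[i]) : R :=
  Num.max (complex.Re (z / 'i ^+ q)) 0.

Lemma part_ge0 q z : 0 <= part q z.
Proof. by rewrite /part le_max lexx orbT. Qed.

Lemma sum_parts z : z = \sum_(q < 4) 'i ^+ q * (part q z)%:C.
Proof.
have maxN (x : R) : x = Num.max x 0 - Num.max (- x) 0.
  case: (lerP 0 x) => x0; first by rewrite max_r ?subr0 // oppr_le0.
  by rewrite max_l ?opprK ?add0r// oppr_ge0 ltW.
rewrite !big_ord_recl big_ord0 /part /=.
rewrite expr0 expr1 sqr_i [_ ^+ 3]exprS sqr_i mulrN1 divr1 invrN1 invrN.
have iV : ('i)^-1 = - 'i :> R[i].
  apply: (mulIf (x := 'i)); rewrite ?mulVf ?mulNr -?expr2 ?sqr_i ?opprK//;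
  by rewrite eq_complex /= oner_eq0 andbF.
rewrite iV; case: z => a b; apply/eqP.
rewrite eq_complex /=; rewrite !(mul0r, mulr0, mul1r, mulr1, subr0, sub0r,
  addr0, add0r, oppr0, opprK, mulNr, mulrN).
by apply/andP; split; apply/eqP; [exact: maxN a|exact: maxN b].
Qed.

Lemma modulus_le z : modulus z <= `|complex.Re z| + `|complex.Im z|.
Proof.
rewrite {1}[z]complexE (le_trans (modulusD _ _))// modulus_real lerD2l.
by rewrite modulusM modulus_real /= expr0n expr1n add0r sqrtr1 mul1r.
Qed.

Lemma Re_le_modulus z : `|complex.Re z| <= modulus z.
Proof. by rewrite -lecR; exact: normc_ge_Re. Qed.

Lemma Im_le_modulus z : `|complex.Im z| <= modulus z.
Proof.
rewrite -[modulus z]ger0_norm ?modulus_ge0// -!sqrtr_sqr ler_wsqrtr//.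
by rewrite -/(msq z) msqE lerDr sqr_ge0.
Qed.

Lemma part_le q z : part q z <= `|complex.Re z| + `|complex.Im z|.
Proof.
apply: le_trans (modulus_le z).
rewrite /part ge_max modulus_ge0 andbT (le_trans (ler_norm _))//.
rewrite (le_trans (Re_le_modulus _))// modulusM modulusV modulusX.
by rewrite [modulus ('i : R[i])]/= expr0n expr1n add0r sqrtr1 expr1n invr1 mulr1.
Qed.

End Parts.

Section MeanProduct.
Context {R : realType} {d : measure_display} {T : measurableType d}.
Variable P : probability T R.

Definition complex_measurable d' (U : measurableType d') (f : U -> R[i]) : Prop :=
  measurable_fun [set: U] (fun y => complex.Re (f y)) /\
  measurable_fun [set: U] (fun y => complex.Im (f y)).

Lemma measurable_part d' (U : measurableType d') (f : U -> R[i]) q :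
  complex_measurable f -> measurable_fun [set: U] (fun y => part q (f y)).
Proof.
move=> [mr mi]; rewrite /part; apply: measurable_maxr; last exact: measurable_cst.
set c := ('i ^+ q)^-1; rewrite (_ : (fun y => _) =
  (fun y => complex.Re (f y) * complex.Re c - complex.Im (f y) * complex.Im c)).
  by apply: measurable_funB; apply: measurable_funM.
by apply/funext => y; case: (f y) c => a b [p r].
Qed.

(** Decompose each factor into its four nonnegative parts, distribute the
    product and apply the nonnegative case to each term. *)
Lemma mean_prod_indep (I : finType) (X : I -> T -> R[i])
    (f : I -> R[i] -> R[i]) (v : I -> R[i]) :
  (forall i, complex_rv (X i)) -> mutually_independent P X ->
  (forall i, complex_measurable (fun y : R * R => f i (y.1 +i* y.2))) ->
  (forall i, mean P (fun w => f i (X i w)) (v i)) ->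
  mean P (fun w => \prod_i f i (X i w)) (\prod_i v i).
Proof.
move=> mX indepX mf fv.
pose g (i : I) q : R * R -> R := fun y => part q (f i (y.1 +i* y.2)).
have gE i q w : g i q (re_im (X i w)) = part q (f i (X i w)).
  by rewrite /g /re_im /=; case: (X i w).
have mg i q : measurable_fun [set: R * R] (g i q) by exact: measurable_part.
have mgX i q : measurable_fun [set: T] (fun w => part q (f i (X i w))).
  under eq_fun do rewrite -gE.
  by apply: (measurableT_comp (mg i q)); exact: (mX i).
have /choice[u uP] (iq : I * 'I_4) :
    exists u, real_mean P (fun w => part iq.2 (f iq.1 (X iq.1 w))) u.
  case: (fv iq.1) => -[ri _] [ii _].
  pose h w := `|complex.Re (f iq.1 (X iq.1 w))| + `|complex.Im (f iq.1 (X iq.1 w))|.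
  have hi : P.-integrable [set: T] (EFin \o h).
    rewrite (_ : _ \o _ = (fun w => `|(complex.Re (f iq.1 (X iq.1 w)))%:E| +
                            `|(complex.Im (f iq.1 (X iq.1 w)))%:E|)%E)//.
    by apply: integrableD => //; exact: integrable_abse.
  apply: (real_mean_le (v := fine (\int[P]_w (h w)%:E)) (g := h)) => //.
    by move=> w; rewrite ger0_norm ?part_ge0 ?part_le.
  by split => //; rewrite fineK//; exact: integrable_fin_num.
have vE i : v i = \sum_(q < 4) 'i ^+ q * (u (i, q))%:C.
  apply: (mean_unique (fv i)).
  under [X in mean _ X]eq_fun do rewrite [f i _]sum_parts.
  by apply: mean_sum => q _; apply: meanZ; apply: mean_real; exact: (uP (i, q)).
under eq_bigr do rewrite vE.
under [X in mean _ X]eq_fun do under eq_bigr do rewrite [f _ _]sum_parts.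
rewrite bigA_distr_bigA /=.
under [X in mean _ X]eq_fun do rewrite bigA_distr_bigA /=.
apply: mean_sum => k _; rewrite big_split /=.
under [X in mean _ X]eq_fun do rewrite big_split /=.
apply: meanZ; rewrite -rmorph_prod.
under [X in mean _ X]eq_fun do rewrite -rmorph_prod.
apply: mean_real; apply: real_mean_ge0.
- by apply: measurable_prod.
- by move=> w; apply: prodr_ge0 => i _; exact: part_ge0.
under eq_integral do under eq_bigr do rewrite -gE.
rewrite (integral_prod_indep_ge0 (P := P) (X := X) (f := fun i => g i (k i)))//.
- rewrite -prodEFin; apply: eq_bigr => i _.
  by under eq_integral do rewrite gE; have [_] := uP (i, k i).
- by move=> i y; exact: part_ge0.
- move=> i; under eq_integral do rewrite gE.
  by have [_ ->] := uP (i, k i).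
Qed.

End MeanProduct.

(** * Orthonormality of products of matrix entries *)

Section SecondMoment.
Context {R : realType} {d : measure_display} {T : measurableType d}.
Variable P : probability T R.

Lemma complex_rvP (X : T -> R[i]) : complex_rv X -> complex_measurable X.
Proof.
move=> mX; split.
  by rewrite (_ : (fun y => _) = fst \o (@re_im R \o X))//; exact: measurableT_comp.
by rewrite (_ : (fun y => _) = snd \o (@re_im R \o X))//; exact: measurableT_comp.
Qed.

Lemma measurable_msq d' (U : measurableType d') (f : U -> R[i]) :
  complex_measurable f -> measurable_fun [set: U] (fun y => msq (f y)).
Proof.
move=> [mr mi]; under eq_fun do rewrite msqE.
by apply: measurable_funD; exact: measurable_funX.
Qed.

Variables (N : nat) (E : T -> 'M[R[i]]_N).
Hypothesis hE : random_matrix_hyp P E.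

Let entry (p : 'I_N * 'I_N) w := E w p.1 p.2.

Let entry_rv p : complex_rv (entry p). Proof. by case: hE => + _ _ _; exact. Qed.

Let mean_msq_entry p : real_mean P (fun w => msq (entry p w)) 1.
Proof.
apply: real_mean_ge0.
- by apply: measurable_msq; apply: complex_rvP.
- by move=> w; exact: msq_ge0.
- by case: hE => _ _ _ /(_ p); rewrite /unit_second_moment unlock.
Qed.

Lemma mean_cst (c : R[i]) : mean P (fun=> c) c.
Proof.
suff cst_mean (r : R) : real_mean P (fun=> r) r by split; exact: cst_mean.
split; first exact: (finite_measure_integrable_cst P r).
by rewrite integral_cst// [X in (_ * X)%E]probability_setT mule1.
Qed.

Let mean_entry p : mean P (entry p) 0.
Proof.
have [mr mi] := complex_rvP (entry_rv p).
have absle (x : R) : `|x| <= 1 + x ^+ 2.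
  rewrite -[x ^+ 2]real_normK ?num_real//; have := sqr_ge0 (`|x| - 1).
  by rewrite sqrrB; have := normr_ge0 x; nra.
have bd : real_mean P (fun w => 1 + msq (entry p w)) (1 + 1).
  by apply: real_meanD; [have [] := mean_cst 1|].
case: hE => _ _ /(_ p) [rE iE] _; rewrite unlock in rE; rewrite unlock in iE.
split.
  have [|u [ui _]] := real_mean_le mr _ bd.
    by move=> w; rewrite (le_trans (absle _))// lerD2l msqE lerDl sqr_ge0.
  by split; [exact: ui|exact: rE].
have [|u [ui _]] := real_mean_le mi _ bd.
  by move=> w; rewrite (le_trans (absle _))// lerD2l msqE lerDr sqr_ge0.
by split; [exact: ui|exact: iE].
Qed.

Definition monomial (h : {ffun 'I_N -> option 'I_N}) (A : 'M[R[i]]_N) : R[i] :=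
  \prod_i (if h i is Some k then A i k else 1).

Lemma monomialE h A :
  monomial h A = \prod_(p : 'I_N * 'I_N) (if h p.1 == Some p.2 then A p.1 p.2 else 1).
Proof.
rewrite -(pair_bigA _ (fun i k => if h i == Some k then A i k else 1)) /=.
apply: eq_bigr => i _; case E1: (h i) => [k|]; last by rewrite big1.
rewrite (bigD1 k)//= eqxx big1 ?mulr1// => j jk.
by case: eqP => // -[kj]; rewrite kj eqxx in jk.
Qed.

Let mean_conj_entry p : mean P (fun w => (entry p w)^*) 0.
Proof.
have [rE iE] := mean_entry p; split.
  under [X in real_mean _ X]eq_fun => w.
    rewrite (_ : complex.Re _ = complex.Re (entry p w)); last by case: (entry p w).
    over.
  exact: rE.
under [X in real_mean _ X]eq_fun => w.
  rewrite (_ : complex.Im _ = -1 * complex.Im (entry p w)); last first.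
    by case: (entry p w) => a b; rewrite /= mulN1r.
  over.
by rewrite (_ : complex.Im 0 = -1 * 0); [exact: real_meanZ|rewrite mulr0].
Qed.

(** In the product over all positions, a position used by both monomials
    contributes E|e|^2 = 1, one used by neither contributes 1, and one used by
    exactly one of them contributes E e = 0 or its conjugate. *)
Lemma mean_monomials h h' :
  mean P (fun w => monomial h (E w) * (monomial h' (E w))^*) (h == h')%:R.
Proof.
pose f (p : 'I_N * 'I_N) (z : R[i]) : R[i] :=
  (if h p.1 == Some p.2 then z else 1) * (if h' p.1 == Some p.2 then z^* else 1).
pose v (p : 'I_N * 'I_N) : R[i] :=
  ((h p.1 == Some p.2) == (h' p.1 == Some p.2))%:R.
have -> : (fun w => monomial h (E w) * (monomial h' (E w))^*) =
          (fun w => \prod_p f p (entry p w)).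
  apply/funext => w; rewrite !monomialE rmorph_prod -big_split /=.
  by apply: eq_bigr => p _; congr (_ * _); case: ifP => // _; exact: conjc1.
have -> : (h == h')%:R = \prod_p v p.
  have [hh'|hh'] := eqVneq h h'.
    by rewrite big1// => p _; rewrite /v hh' eqxx.
  apply/esym/eqP; rewrite prodf_seq_eq0; apply/hasP.
  have [i hi] : exists i, h i != h' i.
    apply/existsP; apply: contraNT hh' => /existsPn H.
    by apply/eqP/ffunP => i; apply/eqP; have := H i; rewrite negbK.
  case E1: (h i) hi => [k|] hi.
    exists (i, k); first by rewrite mem_index_enum.
    by rewrite /= /v /= E1 eqxx eq_sym; move: hi; rewrite eq_sym => /negPf ->.
  case E2: (h' i) hi => [k|] // _.
  exists (i, k); first by rewrite mem_index_enum.
  by rewrite /= /v /= E1 E2 eqxx.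
have mid : complex_measurable (fun y : R * R => y.1 +i* y.2).
  by split => /=; [exact: measurable_fst|exact: measurable_snd].
have mconj : complex_measurable (fun y : R * R => (y.1 +i* y.2)^*).
  split => /=; first exact: measurable_fst.
  by apply: measurable_funN; exact: measurable_snd.
have mmsq : complex_measurable (fun y : R * R => (y.1 +i* y.2) * (y.1 +i* y.2)^*).
  under [X in complex_measurable X]eq_fun do rewrite mulcJ.
  by split => /=; [exact: measurable_msq|exact: measurable_cst].
apply: mean_prod_indep => //.
- by case: hE.
- move=> p; rewrite /f; case: (h p.1 == _); case: (h' p.1 == _).
  + exact: mmsq.
  + by under [X in complex_measurable X]eq_fun do rewrite mulr1.
  + by under [X in complex_measurable X]eq_fun do rewrite mul1r.
  + by split => /=; exact: measurable_cst.
- move=> p; rewrite /f /v; case: (h p.1 == _); case: (h' p.1 == _); rewrite /=.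
  + under [X in mean _ X]eq_fun do rewrite mulcJ.
    exact: (mean_real (mean_msq_entry p)).
  + by under [X in mean _ X]eq_fun do rewrite mulr1.
  + by under [X in mean _ X]eq_fun do rewrite mul1r; exact: mean_conj_entry.
  + by rewrite mulr1; exact: mean_cst.
Qed.

Lemma mean_msq_sum_monomials (Q : pred {ffun 'I_N -> option 'I_N})
    (c : {ffun 'I_N -> option 'I_N} -> R[i]) :
  real_mean P (fun w => msq (\sum_(h | Q h) monomial h (E w) * c h))
    (\sum_(h | Q h) msq (c h)).
Proof.
suff H : mean P (fun w => (msq (\sum_(h | Q h) monomial h (E w) * c h))%:C)
    (\sum_(h | Q h) msq (c h))%:C by case: H.
rewrite (_ : (_)%:C = \sum_(h | Q h) \sum_(h' | Q h') (c h * (c h')^*) * (h == h')%:R).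
  rewrite (_ : (fun w => _) = (fun w => \sum_(h | Q h) \sum_(h' | Q h')
    (c h * (c h')^*) * (monomial h (E w) * (monomial h' (E w))^*))).
    apply: mean_sum => h _; apply: mean_sum => h' _; apply: meanZ.
    exact: mean_monomials.
  apply/funext => w; rewrite -mulcJ rmorph_sum mulr_suml; apply: eq_bigr => h _.
  by rewrite mulr_sumr; apply: eq_bigr => h' _; rewrite rmorphM/=; ring.
rewrite rmorph_sum; apply: eq_bigr => h Qh; rewrite (bigD1 h)//= eqxx mulr1.
rewrite mulcJ big1 ?addr0// => h' /andP[_ hh'].
by rewrite eq_sym (negPf hh') mulr0.
Qed.

End SecondMoment.

(** * Second moment of a perturbed determinant *)

Lemma ffact_le_exp n m : (n ^_ m <= n ^ m)%N.
Proof.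
elim: m n => [|m IH] n //; rewrite ffactnSr expnSr.
by rewrite leq_mul// leq_subr.
Qed.

Lemma sum_geometric_le (R : realFieldType) (x : R) n :
  0 <= x -> x <= 2^-1 -> \sum_(k < n) x ^+ k.+1 <= 2 * x.
Proof.
move=> x0 x2; elim: n => [|n IH]; first by rewrite big_ord0 mulr_ge0.
rewrite big_ord_recl expr1.
under eq_bigr do rewrite exprS.
rewrite -mulr_sumr (eq_bigr (fun i : 'I_n => x ^+ i.+1)) => [|i _]; last first.
  by rewrite /= /bump add1n.
have := ler_wpM2l x0 IH.
have : 0 <= \sum_(i < n) x ^+ i.+1 by apply: sumr_ge0 => i _; exact: exprn_ge0.
nra.
Qed.

Section DetSecondMoment.
Context {R : realType}.

(** Group the maps [h] by support: the C(N, k) supports of size k contribute at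
    most k! t^k each, and C(N, k) k! <= N^k. *)
Lemma sum_minors_bound N (B : 'M[R[i]]_N) (t : R) :
  (forall j, \sum_i msq (B i j) <= 1) -> 0 <= t -> N%:R * t <= 2^-1 ->
  \sum_(h : {ffun 'I_N -> option 'I_N} | h != [ffun=> None])
     t ^+ #|supp h| * msq (\det (select_rows B h)) <= 2 * (N%:R * t).
Proof.
move=> Ble1 t0 Nt.
have supp0 h : (h == [ffun=> None]) = (@supp N h == finset.set0).
  apply/eqP/eqP => [->|/setP hs].
    by apply/setP => i; rewrite !inE ffunE.
  by apply/ffunP => i; rewrite ffunE; have := hs i; rewrite !inE => /negbFE/eqP.
rewrite (partition_big (@supp N) (fun S => S != finset.set0)) /=; last first.
  by move=> h; rewrite supp0.
apply: (@le_trans _ _ (\sum_(S : {set 'I_N} | S != finset.set0)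
    t ^+ #|S| * (#|S|)`!%:R)).
  apply: ler_sum => S S0.
  rewrite (eq_big (fun h => supp h == S)
     (fun h => t ^+ #|S| * msq (\det (select_rows B h)))); last 2 first.
  - move=> h; rewrite supp0; case: eqP => [->|]; rewrite ?andbF ?andbT//.
    by rewrite /= eq_sym (negPf S0).
  - by move=> h /andP[_ /eqP ->].
  rewrite -mulr_sumr ler_wpM2l ?exprn_ge0//.
  rewrite -lecR rmorph_sum rmorph_nat /=; under eq_bigr do rewrite msqC.
  apply: sum_sqr_det_select_rows_le => j.
  under eq_bigr do rewrite -msqC.
  by rewrite -rmorph_sum /= -(rmorph1 (real_complex R)) lecR.
rewrite (partition_big (fun S : {set 'I_N} => inord #|S| : 'I_N.+1)
  (fun k => k != ord0)) /=; last first.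
  move=> S S0; rewrite -val_eqE /= inordK ?cards_eq0//.
  by rewrite ltnS -[leqRHS]card_ord max_card.
apply: (@le_trans _ _ (\sum_(k < N.+1 | k != ord0) (N%:R * t) ^+ k)); last first.
  rewrite big_mkcond big_ord_recl /= add0r.
  apply: le_trans (sum_geometric_le N _ Nt); last by rewrite mulr_ge0.
  by apply: ler_sum => i _; rewrite /bump add1n.
apply: ler_sum => k k0.
rewrite (eq_big (fun S : {set 'I_N} => #|S| == k) (fun=> t ^+ k * k`!%:R)).
- rewrite (eq_bigl (mem [set A : {set 'I_N} | #|A| == k]%SET)) => [|S]; last first.
    by rewrite /= inE.
  rewrite sumr_const card_draws card_ord exprMn -natrX -[leLHS]mulr_natr.
  rewrite [leRHS]mulrC -mulrA ler_wpM2l ?exprn_ge0// -natrM ler_nat mulnC bin_ffact.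
  exact: ffact_le_exp.
- move=> S; have S_le : (#|S| < N.+1)%N by rewrite ltnS -[leqRHS]card_ord max_card.
  rewrite -[inord _ == k]val_eqE /= inordK// andbC; case: eqP => // Sk /=.
  by rewrite -cards_eq0 Sk.
move=> S /andP[_ /eqP <-]; rewrite inordK//.
by rewrite ltnS -[leqRHS]card_ord max_card.
Qed.

Context {d : measure_display} {T : measurableType d}.
Variable P : probability T R.

(** Smallness is relative to N |c|^2 K, where |c|^2 is the variance of the
    entries of the perturbation [c *: E] and K bounds the squared norms of the
    columns of [B]. *)
Lemma mean_msq_det N (E : T -> 'M[R[i]]_N) (B : 'M[R[i]]_N) (c : R[i]) (K : R) :
  random_matrix_hyp P E -> 0 < K -> (forall j, \sum_i msq (B i j) <= K) ->
  N%:R * (msq c * K) <= 2^-1 ->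
  exists2 v, v <= 2 * (N%:R * (msq c * K)) &
    real_mean P (fun w => msq (\det (1%:M + (c *: E w) *m B) - 1)) v.
Proof.
move=> hE K0 BK Nt.
(* divide B by sqrt K, so that its columns have norm at most 1 *)
pose s := Num.sqrt K; have s0 : 0 < s by rewrite sqrtr_gt0.
have sK : s ^+ 2 = K by rewrite sqr_sqrtr// ltW.
pose c' := c * s%:C; pose B' := (s^-1)%:C *: B.
have B'1 j : \sum_i msq (B' i j) <= 1.
  under eq_bigr do rewrite mxE msqM msq_real exprVn sK.
  by rewrite -mulr_sumr ler_pdivrMl// mulr1.
have tE : msq c' = msq c * K by rewrite msqM msq_real sK.
pose e (h : {ffun 'I_N -> option 'I_N}) := c' ^+ #|supp h| * \det (select_rows B' h).
pose Q (h : {ffun 'I_N -> option 'I_N}) := h != [ffun=> None].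
exists (\sum_(h | Q h) msq (e h)).
  have msqX x n : msq (x ^+ n) = msq x ^+ n :> R.
    by elim: n => [|n IH]; rewrite ?expr0 ?msq1// !exprS msqM IH.
  rewrite -tE; under eq_bigr do rewrite msqM msqX.
  by apply: sum_minors_bound => //; [exact: msq_ge0|rewrite tE].
have -> : (fun w => msq (\det (1%:M + c *: E w *m B) - 1)) =
    (fun w => msq (\sum_(h | Q h) monomial h (E w) * e h)).
  apply/funext => w; congr msq.
  have -> : c *: E w *m B = (c' *: E w) *m B'.
    rewrite /B' -scalemxAl -[in RHS]scalemxAl -scalemxAr scalerA.
    by congr (_ *: _); rewrite /c' -mulrA -rmorphM mulfV ?gt_eqF// mulr1.
  rewrite det_add1_mulmx (bigD1 [ffun=> None])//=.
  rewrite big1 => [|i _]; last by rewrite ffunE.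
  rewrite (_ : select_rows _ _ = 1%:M); last first.
    by apply/matrixP => i j; rewrite !mxE ffunE.
  rewrite det1 mulr1 [1 + _]addrC addrK; apply: eq_bigr => h _.
  rewrite mulrA; congr (_ * _); rewrite mulrC /supp /monomial.
  rewrite -prodr_const [X in _ = X * _]big_mkcond -big_split /=; apply: eq_bigr => i _.
  by rewrite inE; case: (h i) => [k|] /=; rewrite ?mxE ?mul1r.
exact: mean_msq_sum_monomials.
Qed.

End DetSecondMoment.

(** * Polynomials without zeros in the unit disc *)

Section Polynomials.
Context {R : realType}.
Implicit Types (p q s : {poly R[i]}) (z u w : R[i]).

Lemma exists_prim_root n : (0 < n)%N -> exists w, n.-primitive_root w.
Proof.
move=> n0; pose p : {poly R[i]} := 'X^n - 1.
have [r Dp] := closed_field_poly_normal p.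
rewrite (monicP _) ?monicXnsubC// scale1r in Dp.
have rn1 : all n.-unity_root r.
  by apply/allP => z; rewrite -root_prod_XsubC -Dp.
have sz_r : (n < (size r).+1)%N.
  by rewrite -(size_prod_XsubC r id) -Dp size_XnsubC.
have [|w _ wP] := hasP (has_prim_root n0 rn1 _ sz_r); last by exists w.
by rewrite -separable_prod_XsubC -Dp separable_Xn_sub_1// pnatr_eq0 -lt0n.
Qed.

Lemma modulus_prim_root n w : n.-primitive_root w -> modulus w = 1.
Proof.
move=> wP; have n0 := prim_order_gt0 wP.
have := congr1 (@modulus R) (prim_expr_order wP); rewrite modulusX Normc.normc1.
by move=> /eqP; rewrite pexpr_eq1 ?modulus_ge0// => /eqP.
Qed.

Lemma coef_by_roots n w p (j : 'I_n) : n.-primitive_root w -> (size p <= n)%N ->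
  n%:R * p`_j = \sum_(k < n) p.[w ^+ k] / w ^+ k ^+ j.
Proof.
move=> wP pn.
have w0 : w != 0 by rewrite -modulus_eq0 (modulus_prim_root wP) oner_eq0.
under eq_bigr => k _ do rewrite (horner_coef_wide _ pn) mulr_suml.
rewrite exchange_big /= (bigD1 j)//= [X in _ + X]big1 ?addr0 => [|i ij].
  under eq_bigr do rewrite mulfK ?expf_neq0//.
  by rewrite sumr_const card_ord mulr_natl.
pose y := w ^+ i / w ^+ j.
have y1 : y != 1.
  apply: contraNneq ij => /(congr1 (fun x => x * w ^+ j)).
  rewrite mul1r divfK ?expf_neq0// => /eqP.
  by rewrite (eq_prim_root_expr wP) !modn_small// => /eqP/val_inj ->.
have yn : y ^+ n = 1.
  by rewrite exprMn exprVn -!exprM ![(_ * n)%N]mulnC !exprM (prim_expr_order wP) !expr1n divr1.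
transitivity (p`_i * \sum_(k < n) y ^+ k).
  rewrite mulr_sumr; apply: eq_bigr => k _; rewrite -mulrA; congr (_ * _).
  by rewrite exprMn exprVn -!exprM ![(k * _)%N]mulnC.
suff -> : \sum_(k < n) y ^+ k = 0 by rewrite mulr0.
by apply: (mulfI (x := y - 1)); rewrite ?subr_eq0// -subrX1 yn subrr mulr0.
Qed.

(** Each coefficient is a discrete Fourier coefficient of the values at the
    roots of unity, hence at most their average modulus; then sum the geometric
    series. This is a discrete form of Cauchy's estimate. *)
Lemma horner_bound_by_roots n w p z : n.-primitive_root w -> (size p <= n)%N ->
  modulus z <= 2^-1 ->
  modulus p.[z] <= 2 * (n%:R^-1 * \sum_(k < n) modulus p.[w ^+ k]).
Proof.
move=> wP pn z2; set a := _^-1 * _.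
have n0 : (0 < n%:R :> R) by rewrite ltr0n (prim_order_gt0 wP).
have pa (j : 'I_n) : modulus p`_j <= a.
  rewrite /a ler_pdivlMl// -[n%:R]ger0_norm// -modulus_real rmorph_nat -modulusM.
  rewrite (coef_by_roots _ wP)// (le_trans (modulus_sum _ _ _))//.
  apply: ler_sum => k _; rewrite modulusM modulusV !modulusX.
  by rewrite (modulus_prim_root wP) !expr1n invr1 mulr1.
rewrite (horner_coef_wide _ pn) (le_trans (modulus_sum _ _ _))//.
apply: (@le_trans _ _ (\sum_(j < n) a * 2^-1 ^+ j)).
  apply: ler_sum => j _; rewrite modulusM modulusX.
  by rewrite ler_pM ?modulus_ge0 ?exprn_ge0 ?modulus_ge0// lerXn2r ?nnegrE ?modulus_ge0.
rewrite -mulr_sumr [leRHS]mulrC ler_wpM2l//.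
  by rewrite mulr_ge0 ?invr_ge0// sumr_ge0// => k _; exact: modulus_ge0.
have h := subrX1 (2^-1 : R) n.
have : 0 <= (2^-1 : R) ^+ n by rewrite exprn_ge0.
lra.
Qed.

(** Truncate the geometric series of 1/(X - a), which converges uniformly on the
    unit disc as |a| > 1. *)
Lemma approx_inverse_linear (a : R[i]) (e : R) : 0 < e ->
  (forall u, modulus u <= 1 -> u - a != 0) ->
  exists s, forall u, modulus u <= 1 -> modulus ((u - a) * s.[u] - 1) <= e.
Proof.
move=> e0 ua.
have a1 : 1 < modulus a.
  by rewrite ltNge; apply/negP => /ua; rewrite subrr eqxx.
have a0 : a != 0 by rewrite -modulus_eq0 gt_eqF// (lt_trans ltr01).
pose b := (modulus a)^-1.
have b0 : 0 <= b by rewrite invr_ge0 modulus_ge0.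
have b1 : b < 1 by rewrite invf_lt1// (lt_trans ltr01).
have [m bm] : exists m, b ^+ m <= e.
  have bl : `|b| < 1 by rewrite ger0_norm.
  have /cvgrPdist_le/(_ _ e0)[m _ /(_ m (leqnn m))] := cvg_expr bl.
  by rewrite sub0r normrN ger0_norm ?exprn_ge0//; exists m.
exists (- a^-1 *: \sum_(l < m) (a^-1 *: 'X) ^+ l) => u u1.
rewrite hornerZ horner_sum.
under eq_bigr do rewrite horner_exp hornerZ hornerX.
have -> : (u - a) * (- a^-1 * \sum_(i < m) (a^-1 * u) ^+ i) = 1 - (a^-1 * u) ^+ m.
  rewrite -[RHS]opprB subrX1 -mulNr mulrA; congr (_ * _).
  by rewrite mulrBl mulrN mulrN divff//; ring.
rewrite addrAC subrr sub0r modulusN modulusX modulusM modulusV.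
apply: le_trans bm; rewrite lerXn2r ?nnegrE ?mulr_ge0 ?modulus_ge0//.
by rewrite ler_piMr.
Qed.

Lemma approx_inverse q (e : R) : 0 < e ->
  (forall u, modulus u <= 1 -> q.[u] != 0) ->
  exists s, forall u, modulus u <= 1 -> modulus (q.[u] * s.[u] - 1) <= e.
Proof.
move=> e0 q0.
have [r qE] := closed_field_poly_normal q.
move: q0; rewrite qE; set c := lead_coef q => q0.
have c0 : c != 0.
  apply/eqP => c0; have := q0 0; rewrite c0 scale0r horner0 eqxx Normc.normc0.
  by move=> /(_ ler01).
suff [s sP] : exists s, forall u, modulus u <= 1 ->
    modulus ((\prod_(a <- r) ('X - a%:P)).[u] * s.[u] - 1) <= e.
  exists (c^-1 *: s) => u u1; rewrite !hornerZ mulrACA divff// mul1r.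
  exact: sP.
have {q0} : forall u, modulus u <= 1 -> (\prod_(a <- r) ('X - a%:P)).[u] != 0.
  by move=> u /q0; rewrite hornerZ mulf_eq0 negb_or => /andP[].
elim: r e e0 {c c0 qE} => [|a r IH] e e0 rn0.
  exists 1 => u u1; rewrite big_nil !hornerC mulr1 subrr Normc.normc0.
  exact: ltW.
(* (x - 1) (y - 1) + (x - 1) + (y - 1) has modulus at most 3 e' as e' <= 1 *)
pose e' := Num.min 1 (e / 3).
have e'0 : 0 < e' by rewrite lt_min ltr01 divr_gt0.
have [|s1 s1P] := @approx_inverse_linear a e' e'0.
  move=> u /rn0; rewrite big_cons hornerM hornerXsubC mulf_eq0 negb_or.
  by move=> /andP[].
have [|s2 s2P] := IH e' e'0.
  move=> u /rn0; rewrite big_cons hornerM mulf_eq0 negb_or.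
  by move=> /andP[].
exists (s1 * s2) => u u1; rewrite big_cons !hornerM hornerXsubC mulrACA.
set x := _ * s1.[u]; set y := _ * s2.[u].
have -> : x * y - 1 = (x - 1) * (y - 1) + ((x - 1) + (y - 1)) by ring.
have hx : modulus (x - 1) <= e' by exact: s1P.
have hy : modulus (y - 1) <= e' by exact: s2P.
have e'1 : e' <= 1 by rewrite ge_min lexx.
have e'3 : e' <= e / 3 by rewrite ge_min lexx orbT.
rewrite (le_trans (modulusD _ _))// modulusM.
have h2 : modulus (x - 1 + (y - 1)) <= e' + e'.
  by rewrite (le_trans (modulusD _ _))// lerD.
have h1 : modulus (x - 1) * modulus (y - 1) <= 1 * e'.
  by rewrite ler_pM ?modulus_ge0// (le_trans hx).
lra.
Qed.

(** The nodes are chosen before [p]: they depend on [p] through a bound on its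
    degree only, so they can serve for all values of a random polynomial. *)
Lemma root_forces_large_average q m :
  (forall u, modulus u <= 1 -> q.[u] != 0) ->
  exists n, exists node : 'I_n -> R[i],
    [/\ (0 < n)%N, forall k, modulus (node k) = 1 &
     forall p z, (size p <= m)%N -> modulus z <= 2^-1 -> p.[z] = 0 ->
     36^-1 <= n%:R^-1 * \sum_k msq (p.[node k] / q.[node k] - 1)].
Proof.
move=> q0; have [s sP] := approx_inverse (ltac:(by []) : 0 < 2^-1 :> R) q0.
(* (p - q) s equals - q s at a zero of p; its size is at most n *)
pose n := (maxn m (size q) + size s).+1.
have [w wP] := @exists_prim_root n isT.
have node1 k : modulus (w ^+ k) = 1.
  by rewrite modulusX (modulus_prim_root wP) expr1n.
exists n, (fun k => w ^+ k); split=> // p z pm z2 pz.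
have gn : (size (p * s - q * s)%R <= n)%N.
  rewrite -mulrBl (leq_trans (size_polyMleq _ _))//.
  rewrite (leq_trans (leq_pred _))// /n ltnW// ltnS leq_add2r.
  by rewrite (leq_trans (size_polyD _ _))// size_polyN geq_max !leq_max pm leqnn orbT.
have := horner_bound_by_roots wP gn z2.
rewrite hornerD hornerN !hornerM pz mul0r sub0r modulusN.
have lo : 2^-1 <= modulus (q.[z] * s.[z]).
  have := sP z; have := modulusD (q.[z] * s.[z]) (- (q.[z] * s.[z] - 1)).
  rewrite modulusN opprB addrC subrK Normc.normc1 => h1 h2.
  have := h2 (le_trans z2 _); lra.
move=> /(le_trans lo) le2.
have hi k : modulus (p * s - q * s).[w ^+ k] <=
    (3 / 2) * modulus (p.[w ^+ k] / q.[w ^+ k] - 1).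
  have qk : q.[w ^+ k] != 0 by rewrite q0// node1.
  have -> : (p * s - q * s).[w ^+ k] =
     (q.[w ^+ k] * s.[w ^+ k]) * (p.[w ^+ k] / q.[w ^+ k] - 1).
    by rewrite hornerD hornerN !hornerM; field.
  rewrite modulusM ler_wpM2r ?modulus_ge0//.
  have := sP (w ^+ k); rewrite node1 => /(_ (lexx _)).
  have := modulusD (q.[w ^+ k] * s.[w ^+ k] - 1) 1.
  rewrite subrK Normc.normc1; lra.
set F := fun k : 'I_n => modulus (p.[w ^+ k] / q.[w ^+ k] - 1).
have nR : 0 < n%:R :> R by rewrite ltr0n.
(* 1/2 <= |q s| at z and |q s| <= 3/2 at the nodes: 1/2 <= 2 (3/2) average *)
have av : 6^-1 <= n%:R^-1 * \sum_k F k.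
  have : \sum_(k < n) modulus (p * s - q * s).[w ^+ k] <= (3 / 2) * \sum_k F k.
    by rewrite mulr_sumr; apply: ler_sum => k _; exact: hi.
  have iR : 0 <= n%:R^-1 :> R by rewrite invr_ge0 ltW.
  by move=> /(ler_wpM2l iR); rewrite mulrCA; move: le2; lra.
have sq := sqr_sum_le F.
have -> : 36^-1 = 6^-1 ^+ 2 :> R by rewrite exprVn -natrX.
apply: (@le_trans _ _ ((n%:R^-1 * \sum_k F k) ^+ 2)).
  by rewrite lerXn2r ?nnegrE// (le_trans _ av).
rewrite exprMn expr2 -mulrA ler_pM2l ?invr_gt0// ler_pdivrMl//.
Qed.

Lemma size_det_le N (M : 'M[{poly R[i]}]_N) :
  (forall i j, (size (M i j) <= 2)%N) -> (size (\det M) <= N.+1)%N.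
Proof.
move=> M2; apply: (leq_trans (size_sum _ _ _)); apply/bigmax_leqP => s _.
rewrite size_Msign (leq_trans (size_poly_prod_leq _ _))//.
rewrite cardT size_enum_ord leq_subLR addnS ltnS.
apply: (@leq_trans (\sum_(i < N) 2)%N); first by apply: leq_sum.
by rewrite sum_nat_const card_ord muln2 -addnn.
Qed.

End Polynomials.

(** * Stability of the finite sections of a Toeplitz operator *)

Section L2.
Context {R : realType}.
Implicit Types (x y : nat -> R[i]).

Definition sqnorm n x : R := \sum_(k < n) msq (x k).

Definition supported n x : Prop := forall k, (n <= k)%N -> x k = 0.

Lemma sqnorm_ge0 n x : 0 <= sqnorm n x.
Proof. by apply: sumr_ge0 => i _; exact: msq_ge0. Qed.

Lemma l2normE x : l2norm x = ((\sum_(k <oo) (msq (x k))%:E) `^ 2^-1)%E.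
Proof.
rewrite /l2norm Lnorm_counting//; congr (_ `^ _)%E.
apply: eq_eseriesr => k _; rewrite /= ger0_norm ?modulus_ge0//.
by rewrite powR_mulrn ?modulus_ge0.
Qed.

Lemma sqnorm_le_series m x : ((sqnorm m x)%:E <= \sum_(k <oo) (msq (x k))%:E)%E.
Proof.
rewrite /sqnorm -sumEFin -(big_mkord xpredT (fun k => (msq (x k))%:E)).
by apply: nneseries_lim_ge => k _ _; rewrite lee_fin msq_ge0.
Qed.

Lemma series_supported n x : supported n x ->
  (\sum_(k <oo) (msq (x k))%:E = (sqnorm n x)%:E)%E.
Proof.
move=> xn; rewrite (nneseries_split 0 n) => [|k _]; last by rewrite lee_fin msq_ge0.
rewrite add0n eseries0 => [|k nk _]; last by rewrite xn// msq0.
by rewrite adde0 big_mkord sumEFin.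
Qed.

Lemma l2_supported n x : supported n x -> l2 x.
Proof. by move=> xn; rewrite /l2 /= l2normE (series_supported xn) /= ltry. Qed.

(** The image of a finitely supported sequence need not be finitely supported;
    all its truncations are bounded. *)
Lemma bounded_sqnorm (V : (nat -> R[i]) -> nat -> R[i]) : l2_bounded_linear V ->
  exists2 M : R, 0 < M & forall n m x, supported n x ->
    sqnorm m (V x) <= M * sqnorm n x.
Proof.
move=> [_ _ [M VM]]; exists (M ^+ 2 + 1); first by rewrite ltr_wpDl ?sqr_ge0.
move=> n m x xn; have := VM x (l2_supported xn).
rewrite !l2normE (series_supported xn) => le1.
have : ((sqnorm m (V x))%:E `^ 2^-1 <= M%:E * (sqnorm n x)%:E `^ 2^-1)%E.
  apply: le_trans le1; apply: gt0_ler_poweR.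
  - by rewrite invr_ge0.
  - by rewrite in_itv /= lee_fin sqnorm_ge0 leey.
  - rewrite in_itv /= leey andbT nneseries_ge0// => k _ _.
    by rewrite lee_fin msq_ge0.
  - exact: sqnorm_le_series.
rewrite !poweR_EFin -EFinM lee_fin !powR12_sqrt ?sqnorm_ge0// => le2.
apply: (@le_trans _ _ (M ^+ 2 * sqnorm n x)); last first.
  by rewrite ler_wpM2r ?sqnorm_ge0// lerDl.
rewrite -[leLHS](sqr_sqrtr (sqnorm_ge0 _ _)) -[X in _ * X](sqr_sqrtr (sqnorm_ge0 _ _)).
rewrite -exprMn lerXn2r ?nnegrE ?sqrtr_ge0//.
by rewrite (le_trans _ le2)// sqrtr_ge0.
Qed.

Lemma sqnorm_widen m n x : (m <= n)%N -> sqnorm m x <= sqnorm n x.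
Proof.
move=> mn; rewrite /sqnorm -!(big_mkord xpredT (fun k => msq (x k))).
by rewrite (big_cat_nat (leq0n m) mn)//= lerDl sumr_ge0// => i _; exact: msq_ge0.
Qed.

Lemma sqnorm_supported m n x : supported n x -> sqnorm m x <= sqnorm n x.
Proof.
move=> xn; have [mn|nm] := leqP m n; first exact: sqnorm_widen.
rewrite /sqnorm -!(big_mkord xpredT (fun k => msq (x k))).
rewrite (big_cat_nat (leq0n n) (ltnW nm))//= -[leRHS]addr0 lerD2l big_nat_cond.
rewrite big1// => k /andP[/andP[nk _] _].
by rewrite xn// msq0.
Qed.

Lemma ext0_shift x (i k e : nat) :
  ext0 x (i%:Z + (k%:Z - e%:Z)) = if (e <= i + k)%N then x (i + k - e)%N else 0.
Proof.
rewrite addrA -PoszD; case: leqP => h.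
  by rewrite subzn.
by have -> : ((i + k)%:Z - e%:Z) = Negz (e - (i + k)).-1 by lia.
Qed.

(** Conditions such as c = j + e are kept symmetric in the two indices until
    one of them is summed out: this is how sums over a band are transposed. *)
Lemma sum_pick (V : nmodType) m c e (F : nat -> V) :
  \sum_(j < m) (if (c == j + e)%N then F j else 0) =
  if (e <= c)%N && (c - e < m)%N then F (c - e)%N else 0.
Proof.
case: ifPn => [/andP[ec cm]|h].
  rewrite (bigD1 (Ordinal cm))//= subnK// eqxx big1 ?addr0// => j jc.
  case: eqP => // cj; case/eqP: jc; apply: val_inj => /=; lia.
rewrite big1// => j _; case: eqP => // cj; case/negP: h.
by have := ltn_ord j; lia.
Qed.

Lemma sum_ext0_le m n (k e : nat) x : supported n x ->
  \sum_(i < m) msq (ext0 x (i%:Z + (k%:Z - e%:Z))) <= sqnorm n x.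
Proof.
move=> xn.
have -> : \sum_(i < m) msq (ext0 x (i%:Z + (k%:Z - e%:Z))) =
    \sum_(i < m) \sum_(j < n) (if (i + k == j + e)%N then msq (x j) else 0).
  apply: eq_bigr => i _; rewrite ext0_shift (sum_pick _ _ _ (fun j => msq (x j))).
  case: (leqP e (i + k)) => h; last by rewrite msq0.
  by case: ltnP => // h2; rewrite xn// msq0.
rewrite exchange_big /=; apply: ler_sum => j _.
under eq_bigr do rewrite eq_sym.
rewrite (sum_pick _ _ _ (fun=> msq (x j))).
by case: ifP => // _; exact: msq_ge0.
Qed.

End L2.

Section Toeplitz.
Context {R : realType}.
Implicit Types (x y : nat -> R[i]) (b : int -> R[i]).

Lemma toeplitz_op_supported d1 d2 b n x :
  supported n x -> supported (n + d2) (toeplitz_op d1 d2 b x).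
Proof.
move=> xn i ni; rewrite /toeplitz_op big1// => k _.
rewrite ext0_shift; case: leqP => [h|_]; last by rewrite mulr0.
by rewrite xn ?mulr0//; lia.
Qed.

Lemma toeplitz_op_lower_bound d1 d2 b : l2_invertible (toeplitz_op d1 d2 b) ->
  exists2 M : R, 0 < M & forall n x, supported n x ->
    sqnorm n x <= M * sqnorm (n + d2) (toeplitz_op d1 d2 b x).
Proof.
move=> [V bV VT]; have [M M0 MP] := bounded_sqnorm bV; exists M => // n x xn.
rewrite -{1}[x](VT _ (l2_supported xn)).1.
exact/MP/toeplitz_op_supported.
Qed.

(** The symbol of the transposed operator. *)
Definition reflect_symbol b : int -> R[i] := fun l => b (- l).

Lemma toeplitz_op_duality d1 d2 b n x y : supported n x ->
  \sum_(i < n) x i * toeplitz_op d1 d2 b y i =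
  \sum_(j < n + d1) toeplitz_op d2 d1 (reflect_symbol b) x j * y j.
Proof.
move=> xn.
transitivity (\sum_(k < (d1 + d2).+1) \sum_(i < n) \sum_(j < n + d1)
    if (i + k == j + d2)%N then b (k%:Z - d2%:Z) * (x i * y j) else 0).
  rewrite exchange_big /=; apply: eq_bigr => i _.
  rewrite /toeplitz_op mulr_sumr; apply: eq_bigr => k _.
  rewrite (sum_pick _ _ _ (fun j => b (k%:Z - d2%:Z) * (x i * y j))) ext0_shift.
  case: (leqP d2 (i + k)) => /= h; last by rewrite !mulr0.
  have -> : (i + k - d2 < n + d1)%N by have := ltn_ord i; have := ltn_ord k; lia.
  by rewrite mulrCA.
rewrite [LHS](reindex_inj rev_ord_inj) /=.
transitivity (\sum_(k < (d2 + d1).+1) \sum_(j < n + d1)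
   reflect_symbol b (k%:Z - d1%:Z) * ext0 x (j%:Z + (k%:Z - d1%:Z)) * y j); last first.
  by rewrite exchange_big /=; apply: eq_bigr => j _; rewrite /toeplitz_op mulr_suml.
rewrite -(big_mkord xpredT (fun k => \sum_(i < n) \sum_(j < n + d1)
    if (i + (d1 + d2 - k) == j + d2)%N
    then b ((d1 + d2 - k)%N%:Z - d2%:Z) * (x i * y j) else 0)).
rewrite addnC big_mkord; apply: eq_bigr => k _; rewrite exchange_big /=.
apply: eq_bigr => j _; have kD := ltn_ord k.
rewrite /reflect_symbol (_ : - (k%:Z - d1%:Z) = (d1 + d2 - k)%N%:Z - d2%:Z); last by lia.
rewrite ext0_shift.
transitivity (\sum_(i < n) if (j + k == i + d1)%N
    then b ((d1 + d2 - k)%N%:Z - d2%:Z) * (x i * y j) else 0).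
  apply: eq_bigr => i _; rewrite (_ : (d2 + d1 - k = d1 + d2 - k)%N); last by lia.
  by congr (if _ then _ else _); apply/eqP/eqP; lia.
rewrite (sum_pick _ _ _ (fun i => b ((d1 + d2 - k)%N%:Z - d2%:Z) * (x i * y j))).
case: (leqP d1 (j + k)) => h /=; last by rewrite mulr0 mul0r.
by case: ltnP => h2; rewrite ?mulrA// xn// mulr0 mul0r.
Qed.

(** With T' the transpose, V the inverse of T and z the conjugate of x, one has
    |x|^2 = (x, T V z) = (T' x, V z), and |V z| is at most a multiple of |x|. *)
Lemma toeplitz_op_lower_bound_reflect d1 d2 b : l2_invertible (toeplitz_op d1 d2 b) ->
  exists2 M : R, 0 < M & forall n x, supported n x ->
    sqnorm n x <= M * sqnorm (n + d1) (toeplitz_op d2 d1 (reflect_symbol b) x).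
Proof.
move=> [V bV VT]; have [M M0 MP] := bounded_sqnorm bV; exists M => // n x xn.
pose z k := (x k)^*.
have zn : supported n z by move=> k nk; rewrite /z xn//; exact: conjc0.
have zx : sqnorm n z = sqnorm n x by apply: eq_bigr => k _; rewrite /z msqJ.
have Tz : toeplitz_op d1 d2 b (V z) = z by exact: (VT _ (l2_supported zn)).2.
have : (sqnorm n x)%:C = \sum_(i < n) x i * toeplitz_op d1 d2 b (V z) i.
  by rewrite Tz rmorph_sum; apply: eq_bigr => i _; rewrite mulcJ.
rewrite toeplitz_op_duality//; set u := toeplitz_op _ _ _ x => /(congr1 (@modulus R)).
rewrite modulus_real ger0_norm ?sqnorm_ge0// => e.
(* the weight M is such that the second term is at most half of the left side *)
have h : sqnorm n x <= 2^-1 *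
    (M * sqnorm (n + d1) u + M^-1 * sqnorm (n + d1) (V z)).
  rewrite {1}e (le_trans (modulus_sum _ _ _))// !mulr_sumr -big_split /= mulr_sumr.
  apply: ler_sum => j _; rewrite modulusM /msq.
  set p := modulus _; set q := modulus _.
  have := sqr_ge0 (M * p - q).
  rewrite -(pmulr_rge0 _ (_ : 0 < M^-1)) ?invr_gt0// => H.
  have -> : 2^-1 * (M * p ^+ 2 + M^-1 * q ^+ 2) = p * q + 2^-1 * (M^-1 * (M * p - q) ^+ 2).
    by field; rewrite gt_eqF.
  by rewrite lerDl mulr_ge0// invr_ge0.
have := MP n (n + d1)%N z zn; rewrite zx -(ler_pM2l (_ : 0 < M^-1)) ?invr_gt0//.
rewrite mulrA mulVf ?gt_eqF// mul1r; lra.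
Qed.

(** The linear ramp 1 - k/N, continued by 0: truncated subtraction. *)
Let cutoff N k : R := (N - k)%N%:R / N%:R.

Lemma cutoff_lipschitz N (i j D : nat) : (i <= j + D)%N -> (j <= i + D)%N ->
  (cutoff N j - cutoff N i) ^+ 2 <= (D%:R / N%:R) ^+ 2.
Proof.
move=> ij ji; rewrite /cutoff -mulrBl !exprMn ler_wpM2r ?sqr_ge0//.
have h1 : ((N - j)%:R : R) <= (N - i)%:R + D%:R by rewrite -natrD ler_nat; lia.
have h2 : ((N - i)%:R : R) <= (N - j)%:R + D%:R by rewrite -natrD ler_nat; lia.
rewrite -subr_ge0 subr_sqr mulr_ge0//; lra.
Qed.

(** Since the ramp is Lipschitz with constant 1/N and the operator has a finite
    band, multiplying by the ramp commutes with the operator up to O(1/N). The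
    ramp vanishes from N on, so only the first N entries of the image of [x]
    are seen, and these are the entries of the truncated matrix product. *)
Lemma sqnorm_cutoff d1 d2 b (M : R) : 0 < M ->
  (forall n x, supported n x ->
    sqnorm n x <= M * sqnorm (n + d2) (toeplitz_op d1 d2 b x)) ->
  exists2 K : R, 0 <= K & forall N x, (0 < N)%N -> supported N x ->
    sqnorm N (fun k => (cutoff N k)%:C * x k) <=
    M * (2 * (sqnorm N (toeplitz_op d1 d2 b x) + K / N%:R * sqnorm N x)).
Proof.
move=> M0 MP; pose D := (d1 + d2)%N.
pose S : R := \sum_(k < D.+1) msq (b (k%:Z - d2%:Z)).
have S0 : 0 <= S by apply: sumr_ge0 => k _; exact: msq_ge0.
exists (D.+1%:R * D%:R ^+ 2 * S) => [|N x N0 xN].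
  by rewrite !mulr_ge0// exprn_ge0.
set y := fun k => _.
have yN : supported N y by move=> k Nk; rewrite /y xN// mulr0.
apply: (le_trans (MP N y yN)); rewrite ler_wpM2l ?(ltW M0)//.
(* the commutator of the operator with the ramp *)
pose c i : R[i] := \sum_(k < D.+1) b (k%:Z - d2%:Z) *
  (((cutoff N (i + k - d2))%:C - (cutoff N i)%:C) * ext0 x (i%:Z + (k%:Z - d2%:Z))).
have TyE i : toeplitz_op d1 d2 b y i = (cutoff N i)%:C * toeplitz_op d1 d2 b x i + c i.
  rewrite /toeplitz_op mulr_sumr -big_split /=; apply: eq_bigr => k _.
  by rewrite !ext0_shift /y; case: leqP => _; ring.
apply: (@le_trans _ _ (\sum_(i < N + d2)
   2 * (msq ((cutoff N i)%:C * toeplitz_op d1 d2 b x i) + msq (c i)))).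
  by apply: ler_sum => i _; rewrite TyE msqD.
rewrite -mulr_sumr ler_wpM2l// big_split /= lerD//.
  pose y' i := (cutoff N i)%:C * toeplitz_op d1 d2 b x i.
  apply: (@le_trans _ _ (sqnorm (N + d2) y')); first by [].
  apply: (le_trans (sqnorm_supported (n := N) _ _)).
    by move=> k Nk; rewrite /y' /cutoff (eqP (_ : N - k == 0)%N) ?subn_eq0// mul0r mul0r.
  apply: ler_sum => i _; rewrite /y' msqM msq_real ler_piMl ?msq_ge0// expr_le1//.
    by rewrite /cutoff ler_pdivrMr ?ltr0n// mul1r ler_nat leq_subr.
  by rewrite /cutoff divr_ge0.
have cle i : msq (c i) <= D.+1%:R * \sum_(k < D.+1) msq (b (k%:Z - d2%:Z)) *
    ((D%:R / N%:R) ^+ 2 * msq (ext0 x (i%:Z + (k%:Z - d2%:Z)))).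
  apply: (le_trans (msq_sum _)); rewrite ler_wpM2l//; apply: ler_sum => k _.
  rewrite msqM ler_wpM2l ?msq_ge0//.
  rewrite ext0_shift; case: leqP => h; last by rewrite mulr0 msq0 mulr0.
  rewrite msqM ler_wpM2r ?msq_ge0// -rmorphB msq_real cutoff_lipschitz//;
  have := ltn_ord k; rewrite /D; lia.
apply: le_trans; first by apply: ler_sum => i _; exact: (cle i).
rewrite -mulr_sumr exchange_big /=.
apply: (@le_trans _ _ (D.+1%:R * \sum_(k < D.+1) msq (b (k%:Z - d2%:Z)) *
    ((D%:R / N%:R) ^+ 2 * sqnorm N x))).
  rewrite ler_wpM2l//; apply: ler_sum => k _.
  rewrite -mulr_sumr ler_wpM2l ?msq_ge0// -mulr_sumr ler_wpM2l ?sqr_ge0//.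
  exact: sum_ext0_le.
rewrite -mulr_suml -/S.
have -> : D.+1%:R * (S * ((D%:R / N%:R) ^+ 2 * sqnorm N x)) =
   (D.+1%:R * D%:R ^+ 2 * S) / N%:R * sqnorm N x * N%:R^-1 by rewrite exprMn; ring.
rewrite ler_piMr ?invf_le1 ?ltr0n ?ler1n//.
by rewrite !mulr_ge0 ?sqnorm_ge0 ?invr_ge0 ?exprn_ge0.
Qed.

Let reverse N x : nat -> R[i] := fun k => if (k < N)%N then x (N - k.+1)%N else 0.

Lemma toeplitz_op_reverse d1 d2 b N x (i : nat) : supported N x -> (i < N)%N ->
  toeplitz_op d2 d1 (reflect_symbol b) (reverse N x) i =
  toeplitz_op d1 d2 b x (N - i.+1).
Proof.
move=> xN iN; rewrite /toeplitz_op [RHS](reindex_inj rev_ord_inj) /=.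
rewrite -(big_mkord xpredT (fun k => b ((d1 + d2 - k)%N%:Z - d2%:Z) *
   ext0 x ((N - i.+1)%N%:Z + ((d1 + d2 - k)%N%:Z - d2%:Z)))).
rewrite addnC big_mkord; apply: eq_bigr => k _; have kD := ltn_ord k.
rewrite /reflect_symbol; congr (_ * _); first by congr b; lia.
rewrite !ext0_shift /reverse.
case: (leqP d1 (i + k)) => h1; last first.
  by case: ifP => // h2; rewrite xN//; lia.
case: ltnP => h2.
  by rewrite ifT; [congr x; lia|lia].
by case: ifP => // h3; exfalso; lia.
Qed.

Lemma sqnorm_reverse N x y : (forall k, (k < N)%N -> y k = x (N - k.+1)%N) ->
  sqnorm N y = sqnorm N x.
Proof.
move=> yx; rewrite /sqnorm [RHS](reindex_inj rev_ord_inj) /=.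
by apply: eq_bigr => k _; rewrite yx.
Qed.

(** The ramp and its mirror image add up to (N + 1)/N, so one of the two halves
    of [x] is large; each is bounded by the image, up to an error O(1/N) that
    the left-hand side absorbs for large N. *)
Lemma toeplitz_op_stable d1 d2 b : l2_invertible (toeplitz_op d1 d2 b) ->
  exists2 C : R, 0 < C & \forall N \near \oo, forall x, supported N x ->
    sqnorm N x <= C * sqnorm N (toeplitz_op d1 d2 b x).
Proof.
move=> Tinv.
have [M M0 /(sqnorm_cutoff M0)[K K0 KP]] := toeplitz_op_lower_bound Tinv.
have [M' M'0 /(sqnorm_cutoff M'0)[K' K'0 KP']] := toeplitz_op_lower_bound_reflect Tinv.
exists (8 * (M + M')); first by rewrite mulr_gt0 ?addr_gt0.
(* for N >= B the error terms are at most half of the left side *)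
pose B : R := 8 * (M * K + M' * K').
exists (Num.truncn B).+1 => // N /= BN x xN.
have N0 : (0 < N)%N by rewrite (leq_trans _ BN).
have NR : 0 < N%:R :> R by rewrite ltr0n.
have B0 : 0 <= B by rewrite mulr_ge0// addr_ge0// mulr_ge0// ltW.
have BNR : B / N%:R <= 1.
  rewrite ler_pdivrMr// mul1r ltW// (lt_le_trans (truncnS_gt _))//.
  by rewrite ler_nat.
pose x' := reverse N x.
have x'N : supported N x' by move=> k Nk; rewrite /x' /reverse ltnNge Nk.
have h1 := KP N x N0 xN; have h2 := KP' N x' N0 x'N.
rewrite [sqnorm N x'](sqnorm_reverse (x := x)) in h2; last first.
  by move=> k kN; rewrite /x' /reverse kN.
rewrite [sqnorm N (toeplitz_op d2 _ _ _)](sqnorm_reverse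
  (x := toeplitz_op d1 d2 b x)) in h2; last first.
  by move=> k kN; exact: toeplitz_op_reverse.
rewrite (sqnorm_reverse (x := fun k => (cutoff N (N - k.+1))%:C * x k)) in h2; last first.
  move=> k kN; rewrite /x' /reverse kN; congr ((cutoff N _)%:C * _); lia.
set TX := sqnorm N (toeplitz_op d1 d2 b x) in h1 h2 *.
set X := sqnorm N x in h1 h2 *.
have TX0 : 0 <= TX by exact: sqnorm_ge0.
have X0 : 0 <= X by exact: sqnorm_ge0.
have h : X <= 2 * (sqnorm N (fun k => (cutoff N k)%:C * x k) +
                   sqnorm N (fun k => (cutoff N (N - k.+1))%:C * x k)).
  rewrite /X /sqnorm -big_split mulr_sumr; apply: ler_sum => k _ /=.
  rewrite !msqM !msq_real -mulrDl mulrA ler_peMl ?msq_ge0//.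
  have : 1 <= cutoff N k + cutoff N (N - k.+1).
    by rewrite /cutoff -mulrDl -natrD ler_pdivlMr// mul1r ler_nat; have := ltn_ord k; lia.
  have := sqr_ge0 (cutoff N k - cutoff N (N - k.+1)).
  by set u := cutoff N k; set v := cutoff N _; nra.
have BX : B / N%:R * X <= X by rewrite ler_piMl.
have BE : B / N%:R * X = 8 * (M * (K / N%:R * X) + M' * (K' / N%:R * X)).
  by rewrite /B; ring.
have : 8 * (M + M') * TX = 4 * (M * (2 * TX) + M' * (2 * TX)) by ring.
move: h1 h2 h; nra.
Qed.

End Toeplitz.

(** * Uniform lower bounds for shifted Toeplitz matrices *)

Section LowerBounds.
Context {R : realType}.

Definition vnorm N (v : 'cV[R[i]]_N) : R := \sum_i msq (v i 0).

Definition lower_bounded N (C : R) (A : 'M[R[i]]_N) : Prop :=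
  forall v, vnorm v <= C * vnorm (A *m v).

Lemma vnorm_ge0 N (v : 'cV[R[i]]_N) : 0 <= vnorm v.
Proof. by apply: sumr_ge0 => i _; exact: msq_ge0. Qed.

Lemma vnorm_eq0 N (v : 'cV[R[i]]_N) : vnorm v = 0 -> v = 0.
Proof.
move=> v0; apply/matrixP => i j; rewrite [j]ord1 [RHS]mxE.
apply/eqP; rewrite -msq_eq0; apply/eqP.
by apply: (psumr_eq0P (P := xpredT) _ v0) => // k _; exact: msq_ge0.
Qed.

Lemma vnormD N (v w : 'cV[R[i]]_N) : vnorm (v + w) <= 2 * (vnorm v + vnorm w).
Proof.
rewrite /vnorm -big_split mulr_sumr; apply: ler_sum => i _ /=.
by rewrite mxE msqD.
Qed.

Lemma vnormZ N (c : R[i]) (v : 'cV[R[i]]_N) : vnorm (c *: v) = msq c * vnorm v.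
Proof.
by rewrite /vnorm mulr_sumr; apply: eq_bigr => i _; rewrite mxE msqM.
Qed.

Lemma lower_bounded_unitmx N C (A : 'M[R[i]]_N) : lower_bounded C A ->
  A \in unitmx /\ forall j, \sum_i msq (invmx A i j) <= C.
Proof.
move=> AC; have Au : A \in unitmx.
  rewrite -unitmx_tr unitmxE unitfE; apply/det0P => -[v v0 vA].
  case/eqP: v0; apply: trmx_inj; rewrite trmx0; apply: vnorm_eq0.
  apply/eqP; rewrite eq_le vnorm_ge0 andbT (le_trans (AC _))//.
  rewrite -[A]trmxK -trmx_mul vA trmx0 /vnorm big1 ?mulr0// => i _.
  by rewrite mxE msq0.
split=> // j; have := AC (col j (invmx A)).
rewrite colE mulmxA mulmxV// mul1mx.
have -> : vnorm (delta_mx j 0) = 1 :> R.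
  rewrite /vnorm (bigD1 j)//= mxE !eqxx msq1 big1 ?addr0// => i ij.
  by rewrite mxE (negPf ij) msq0.
rewrite mulr1 -colE; apply: le_trans.
by rewrite /vnorm ler_sum// => i _; rewrite mxE.
Qed.

Variables (d1 d2 : nat) (a : int -> R[i]).

Let extend N (v : 'cV[R[i]]_N) : nat -> R[i] :=
  fun k => if insub k is Some i then v i 0 else 0.

Lemma extend_supported N (v : 'cV[R[i]]_N) : supported N (extend v).
Proof. by move=> k Nk; rewrite /extend insubN// -leqNgt. Qed.

Lemma extendE N (v : 'cV[R[i]]_N) (i : 'I_N) : extend v i = v i 0.
Proof. by rewrite /extend valK. Qed.

Lemma sqnorm_extend N (v : 'cV[R[i]]_N) : sqnorm N (extend v) = vnorm v.
Proof. by apply: eq_bigr => i _; rewrite extendE. Qed.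

Lemma toeplitz_mx_mul b N (v : 'cV[R[i]]_N) i :
  (toeplitz_mx d1 d2 b N *m v) i 0 = toeplitz_op d1 d2 b (extend v) i.
Proof.
rewrite mxE; transitivity (\sum_(j < N) \sum_(k < (d1 + d2).+1)
   if (j + d2 == k + i)%N then b (k%:Z - d2%:Z) * v j 0 else 0).
  apply: eq_bigr => j _.
  rewrite (sum_pick _ _ _ (fun k => b (k%:Z - d2%:Z) * v j 0)) mxE.
  case: ifPn => h1; case: ifPn => h2; rewrite ?mul0r//.
  - by congr (b _ * _); lia.
  - by exfalso; lia.
  - by exfalso; lia.
rewrite exchange_big /=; apply: eq_bigr => k _.
rewrite ext0_shift; transitivity (\sum_(j < N) if (i + k == j + d2)%N
    then b (k%:Z - d2%:Z) * extend v j else 0).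
  apply: eq_bigr => j _; rewrite extendE; congr (if _ then _ else _).
  by apply/eqP/eqP; lia.
rewrite (sum_pick _ _ _ (fun j => b (k%:Z - d2%:Z) * extend v j)).
case: (leqP d2 (i + k)) => h /=; last by rewrite mulr0.
by case: ltnP => // h2; rewrite extend_supported// mulr0.
Qed.

Let shift z : int -> R[i] := fun l => a l - (if l == 0 then z else 0).

Lemma toeplitz_op_shift z x :
  toeplitz_op d1 d2 (shift z) x = (fun k => toeplitz_op d1 d2 a x k - z * x k).
Proof.
apply/funext => i; rewrite /toeplitz_op.
under eq_bigr do rewrite /shift mulrBl.
rewrite sumrB; congr (_ - _).
have h : (d2 < (d1 + d2).+1)%N by lia.
rewrite (bigD1 (Ordinal h))//= subrr eqxx addr0 big1 ?addr0// => k kh.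
rewrite ifN ?mul0r//; apply: contra kh => /eqP k0.
by apply/eqP/val_inj => /=; lia.
Qed.

Lemma toeplitz_mx_shift z N :
  toeplitz_mx d1 d2 (shift z) N = toeplitz_mx d1 d2 a N - z%:M.
Proof.
apply/matrixP => i j; rewrite !mxE /shift.
have [<-|ij] := eqVneq i j.
  rewrite subrr eqxx mulr1n ifT; last by lia.
  by rewrite ifT//; lia.
rewrite mulr0n subr0; case: ifP => // _.
by rewrite ifN ?subr0//; apply: contra ij => /eqP h; apply/eqP/val_inj => /=; lia.
Qed.

Lemma toeplitz_mx_stable z : ~ l2_spectrum (toeplitz_op d1 d2 a) z ->
  exists2 C : R, 0 < C & \forall N \near \oo,
    lower_bounded C (toeplitz_mx d1 d2 a N - z%:M).
Proof.
rewrite /l2_spectrum /= => /contrapT; under eq_fun do rewrite -toeplitz_op_shift.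
move=> /toeplitz_op_stable[C C0 stab]; exists C => //.
apply: filterS stab => N stab v.
have := stab _ (extend_supported v); rewrite sqnorm_extend.
suff -> : sqnorm N (toeplitz_op d1 d2 (shift z) (extend v)) =
    vnorm ((toeplitz_mx d1 d2 a N - z%:M) *m v) by [].
by apply: eq_bigr => i _; rewrite -toeplitz_mx_shift toeplitz_mx_mul.
Qed.

(** A lower bound survives a perturbation by a small multiple of the identity,
    uniformly in N. *)
Lemma toeplitz_mx_stable_disc z : ~ l2_spectrum (toeplitz_op d1 d2 a) z ->
  exists r C : R, [/\ 0 < r, 0 < C & \forall N \near \oo,
    forall z', modulus (z' - z) <= r ->
    lower_bounded C (toeplitz_mx d1 d2 a N - z'%:M)].
Proof.
move=> /toeplitz_mx_stable[C C0 stab].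
(* then 2 C r^2 = 1/2 *)
exists (Num.sqrt (4 * C)^-1), (4 * C); split.
- by rewrite sqrtr_gt0 invr_gt0 mulr_gt0.
- by rewrite mulr_gt0.
apply: filterS stab => N stab z' z'z v.
have zz : msq (z' - z) <= (4 * C)^-1.
  rewrite -[leRHS]sqr_sqrtr ?invr_ge0 ?mulr_ge0 ?(ltW C0)//.
  by rewrite lerXn2r ?nnegrE ?modulus_ge0 ?sqrtr_ge0.
have := stab v; set A := toeplitz_mx _ _ _ _.
have -> : (A - z%:M) *m v = (A - z'%:M) *m v + (z' - z) *: v.
  by rewrite -mul_scalar_mx -mulmxDl raddfB addrA subrK.
have := vnormD ((A - z'%:M) *m v) ((z' - z) *: v); rewrite vnormZ.
set x := vnorm v; set y := vnorm ((A - z'%:M) *m v); set t := vnorm _.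
move=> h1 h2; have x0 : 0 <= x by exact: vnorm_ge0.
have h3 : C * (msq (z' - z) * x) <= 4^-1 * x.
  rewrite mulrA ler_wpM2r// (le_trans (ler_wpM2l (ltW C0) zz))//.
  by rewrite invfM mulrCA divff ?gt_eqF// mulr1.
have := ler_wpM2l (ltW C0) h1; lra.
Qed.

(** The matrices T_N are bounded uniformly in N, since each row has at most
    d1 + d2 + 1 nonzero entries, so a large multiple of the identity dominates
    them. *)
Lemma toeplitz_mx_stable_infinity : exists2 r : R, 0 < r &
  forall N u, modulus u <= 1 ->
    lower_bounded 1 (u *: toeplitz_mx d1 d2 a N - r%:C%:M).
Proof.
pose K : R := (d1 + d2).+1%:R * \sum_(k < (d1 + d2).+1) msq (a (k%:Z - d2%:Z)).
have K0 : 0 <= K by rewrite mulr_ge0// sumr_ge0// => k _; exact: msq_ge0.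
have TK N v : vnorm (toeplitz_mx d1 d2 a N *m v) <= K * vnorm v.
  rewrite /vnorm; under eq_bigr do rewrite toeplitz_mx_mul.
  apply: (@le_trans _ _ (\sum_(i < N) (d1 + d2).+1%:R * \sum_(k < (d1 + d2).+1)
      msq (a (k%:Z - d2%:Z)) * msq (ext0 (extend v) (i%:Z + (k%:Z - d2%:Z))))).
    apply: ler_sum => i _; apply: (le_trans (msq_sum _)).
    by rewrite ler_wpM2l//; apply: ler_sum => k _; rewrite msqM.
  rewrite -mulr_sumr /K -mulrA ler_wpM2l// exchange_big mulr_suml /=.
  apply: ler_sum => k _; rewrite -mulr_sumr ler_wpM2l ?msq_ge0//.
  rewrite -/(vnorm v) -sqnorm_extend; apply: sum_ext0_le.
  exact: extend_supported.
(* r^2 |v|^2 <= 2 |u T v|^2 + 2 |(u T - r) v|^2, with |u T v|^2 <= K |v|^2 *)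
exists (Num.sqrt (2 * K + 2)); first by rewrite sqrtr_gt0; lra.
set r := Num.sqrt _; have r2 : r ^+ 2 = 2 * K + 2 by rewrite sqr_sqrtr//; lra.
move=> N u u1 v; rewrite mul1r; set T := toeplitz_mx _ _ _ _.
have rv : r%:C *: v = u *: (T *m v) + (- 1) *: ((u *: T - r%:C%:M) *m v).
  by rewrite mulmxBl mul_scalar_mx -scalemxAl scaleN1r opprB addrC subrK.
have := vnormZ r%:C v; rewrite rv => e.
have := vnormD (u *: (T *m v)) (- 1 *: ((u *: T - r%:C%:M) *m v)).
rewrite e msq_real r2 !vnormZ msqN msq1 mul1r => h.
have u2 : msq u * vnorm (T *m v) <= K * vnorm v.
  apply: le_trans (TK N v); rewrite ler_piMl ?vnorm_ge0//.
  by rewrite /msq expr_le1// modulus_ge0.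
lra.
Qed.

End LowerBounds.

(** * Exceptional event of a disc *)

Section ComplexMeasurable.
Context {R : realType} {d : measure_display} {T : measurableType d}.
Implicit Types f g : T -> R[i].

Lemma complex_measurable_cst (c : R[i]) : complex_measurable (fun _ : T => c).
Proof. by split; exact: measurable_cst. Qed.

Lemma complex_measurableD f g : complex_measurable f -> complex_measurable g ->
  complex_measurable (fun w => f w + g w).
Proof.
move=> [fr fi] [gr gi]; split.
  by under eq_fun do rewrite raddfD /=; exact: measurable_funD.
by under eq_fun do rewrite raddfD /=; exact: measurable_funD.
Qed.

Lemma complex_measurableM f g : complex_measurable f -> complex_measurable g ->
  complex_measurable (fun w => f w * g w).
Proof.
move=> [fr fi] [gr gi]; split.
  rewrite (_ : (fun w => _) = (fun w => complex.Re (f w) * complex.Re (g w) -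
      complex.Im (f w) * complex.Im (g w))).
    by apply: measurable_funB; exact: measurable_funM.
  by apply/funext => w; case: (f w) (g w) => a b [c e].
rewrite (_ : (fun w => _) = (fun w => complex.Re (f w) * complex.Im (g w) +
    complex.Im (f w) * complex.Re (g w))).
  by apply: measurable_funD; exact: measurable_funM.
by apply/funext => w; case: (f w) (g w) => a b [c e].
Qed.

Lemma complex_measurable_sum (I : Type) (s : seq I) (F : I -> T -> R[i]) :
  (forall i, complex_measurable (F i)) ->
  complex_measurable (fun w => \sum_(i <- s) F i w).
Proof.
move=> mF; elim: s => [|i s IH].
  by under [X in complex_measurable X]eq_fun do rewrite big_nil; exact: complex_measurable_cst.
under [X in complex_measurable X]eq_fun do rewrite big_cons.
exact: complex_measurableD.
Qed.

Lemma complex_measurable_prod (I : Type) (s : seq I) (F : I -> T -> R[i]) :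
  (forall i, complex_measurable (F i)) ->
  complex_measurable (fun w => \prod_(i <- s) F i w).
Proof.
move=> mF; elim: s => [|i s IH].
  by under [X in complex_measurable X]eq_fun do rewrite big_nil; exact: complex_measurable_cst.
under [X in complex_measurable X]eq_fun do rewrite big_cons.
exact: complex_measurableM.
Qed.

Lemma complex_measurable_det N (A : T -> 'M[R[i]]_N) :
  (forall i j, complex_measurable (fun w => A w i j)) ->
  complex_measurable (fun w => \det (A w)).
Proof.
move=> mA; apply: complex_measurable_sum => s; apply: complex_measurableM.
  exact: complex_measurable_cst.
by apply: complex_measurable_prod.
Qed.

Lemma markov_real_mean (P : probability T R) (f : T -> R) (v a : R) : 0 < a ->
  measurable_fun [set: T] f -> (forall w, 0 <= f w) -> real_mean P f v ->
  measurable [set w | a <= f w] /\ (P [set w | (a <= f w)%R] <= (a^-1 * v)%:E)%E.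
Proof.
move=> a0 mf f0 [_ fv].
have mA : measurable [set w | a <= f w].
  rewrite (_ : mkset _ = f @^-1` `[a, +oo[%classic).
    by rewrite -[X in measurable X]setTI; exact: mf.
  by apply/seteqP; split => w /=; rewrite in_itv /= andbT.
split => //.
rewrite EFinM -lee_pdivrMl ?invr_gt0// invrK -fv.
have := integral_indic P measurableT mA; rewrite setIT => <-.
rewrite -ge0_integralZl_EFin//; last 2 first.
- by apply/measurable_EFinP; exact: measurable_indic.
- exact: ltW.
apply: ge0_le_integral => //.
- by move=> w _; rewrite -EFinM lee_fin indicE mulr_ge0// ltW.
- apply/measurable_EFinP; apply: measurable_funM => //.
- exact/measurable_EFinP.
move=> w _; rewrite -EFinM lee_fin indicE; case: (boolP (w \in _)) => wA.
  by rewrite mulr1; exact: (set_mem wA).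
by rewrite mulr0.
Qed.

End ComplexMeasurable.

Section DiscEvent.
Context {R : realType}.

(** The polynomial u |-> det(A0 + u A1). *)
Definition pencil N (A0 A1 : 'M[R[i]]_N) : {poly R[i]} :=
  \det (map_mx polyC A0 + 'X *: map_mx polyC A1).

Lemma horner_pencil N (A0 A1 : 'M[R[i]]_N) u :
  (pencil A0 A1).[u] = \det (A0 + u *: A1).
Proof.
rewrite -horner_evalE -det_map_mx; congr (\det _).
by apply/matrixP => i j; rewrite !mxE /= /horner_eval hornerD hornerM hornerX !hornerC.
Qed.

Lemma size_pencil N (A0 A1 : 'M[R[i]]_N) : (size (pencil A0 A1) <= N.+1)%N.
Proof.
apply: size_det_le => i j; rewrite !mxE (leq_trans (size_polyD _ _))// geq_max.
rewrite (leq_trans (size_polyC_leq1 _))//= (leq_trans (size_polyMleq _ _))//.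
by rewrite size_polyX add2n /= ltnS size_polyC_leq1.
Qed.

Context {d : measure_display} {T : measurableType d}.
Variable P : probability T R.

(** The two weights of the noise make the statement apply both to a disc
    z = c + r u, where Delta does not depend on u, and to a neighbourhood of
    infinity, where the pencil is u (T_N + Delta) - r. *)
Lemma disc_event N (E : T -> 'M[R[i]]_N) (M0 M1 : 'M[R[i]]_N) (v0 v1 : R[i]) (s K : R) :
  random_matrix_hyp P E -> 0 < K ->
  (forall u, modulus u <= 1 -> lower_bounded K (M0 + u *: M1)) ->
  (forall u, modulus u <= 1 -> modulus (v0 + u * v1) <= 1) ->
  N%:R * (s ^+ 2 * K) <= 2^-1 ->
  exists A : set T, [/\ measurable A,
    (P A <= (72 * (N%:R * (s ^+ 2 * K)))%:E)%E &
    forall w z, modulus z <= 2^-1 ->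
    \det (M0 + v0 *: (s%:C *: E w) + z *: (M1 + v1 *: (s%:C *: E w))) = 0 -> A w].
Proof.
move=> hE K0 MK v01 NsK.
pose q := pencil M0 M1.
have unit_u u : modulus u <= 1 -> M0 + u *: M1 \in unitmx.
  by move=> /MK /lower_bounded_unitmx[].
have q0 u : modulus u <= 1 -> q.[u] != 0.
  by move=> /unit_u; rewrite horner_pencil unitmxE unitfE.
have [n [node [n0 node1 nodeP]]] := root_forces_large_average N.+1 q0.
pose p w := pencil (M0 + v0 *: (s%:C *: E w)) (M1 + v1 *: (s%:C *: E w)).
pose c k := (v0 + node k * v1) * s%:C.
pose B k := invmx (M0 + node k *: M1).
have pq k w : (p w).[node k] / q.[node k] = \det (1%:M + (c k *: E w) *m B k).
  have k1 : modulus (node k) <= 1 by rewrite node1.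
  apply: (mulIf (q0 _ k1)); rewrite divfK ?q0//.
  rewrite !horner_pencil -det_mulmx; congr (\det _).
  rewrite mulmxDl mul1mx -mulmxA mulVmx ?unit_u// mulmx1.
  rewrite !scalerDr !scalerA addrACA -scalerDl; congr (_ + _ *: _).
  by rewrite /c; ring.
have NR : 0 < n%:R :> R by rewrite ltr0n.
have ck k : msq (c k) <= s ^+ 2.
  rewrite msqM msq_real ler_piMl ?sqr_ge0// /msq expr_le1// ?modulus_ge0//.
  by rewrite v01// node1.
have /choice[v vP] (k : 'I_n) : exists v, v <= 2 * (N%:R * (s ^+ 2 * K)) /\
    real_mean P (fun w => msq ((p w).[node k] / q.[node k] - 1)) v.
  have k1 : modulus (node k) <= 1 by rewrite node1.
  have [_ BK] := lower_bounded_unitmx (MK _ k1).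
  have le : N%:R * (msq (c k) * K) <= N%:R * (s ^+ 2 * K).
    by rewrite ler_wpM2l// ler_wpM2r// ltW.
  have [v vle mv] := mean_msq_det hE K0 BK (le_trans le NsK).
  exists v; split; first by rewrite (le_trans vle)// ler_wpM2l.
  by under [X in real_mean _ X]eq_fun do rewrite pq.
pose f w := n%:R^-1 * \sum_k msq ((p w).[node k] / q.[node k] - 1).
have mE i j : complex_measurable (fun w => E w i j).
  by case: hE => mE _ _ _; apply: complex_rvP; exact: (mE (i, j)).
have mf : measurable_fun [set: T] f.
  apply: measurable_funM; first exact: measurable_cst.
  apply: measurable_sum => k; apply: measurable_msq.
  under [X in complex_measurable X]eq_fun do rewrite pq.
  apply: complex_measurableD; last exact: complex_measurable_cst.
  apply: complex_measurable_det => i j.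
  under [X in complex_measurable X]eq_fun do rewrite mxE [X in _ + X]mxE.
  apply: complex_measurableD; first exact: complex_measurable_cst.
  apply: complex_measurable_sum => l.
  apply: complex_measurableM; last exact: complex_measurable_cst.
  under [X in complex_measurable X]eq_fun do rewrite mxE.
  by apply: complex_measurableM => //; exact: complex_measurable_cst.
have f0 w : 0 <= f w.
  by rewrite mulr_ge0 ?invr_ge0 ?sumr_ge0// => k _; exact: msq_ge0.
have meanf : real_mean P f (n%:R^-1 * \sum_k v k).
  apply: real_meanZ.
  suff H : mean P (fun w => (\sum_k msq ((p w).[node k] / q.[node k] - 1))%:C)
     (\sum_k v k)%:C by case: H.
  rewrite rmorph_sum; under [X in mean _ X]eq_fun do rewrite rmorph_sum.
  by apply: mean_sum => k _; apply: mean_real; case: (vP k).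
have [mA PA] := markov_real_mean (ltac:(by []) : 0 < 36^-1 :> R) mf f0 meanf.
exists [set w | 36^-1 <= f w]; split => //.
  apply: (le_trans PA); rewrite lee_fin invrK.
  have -> : 72 * (N%:R * (s ^+ 2 * K)) = 36 * (2 * (N%:R * (s ^+ 2 * K))) by ring.
  rewrite ler_wpM2l// ler_pdivrMl//.
  apply: (@le_trans _ _ (\sum_(k < n) 2 * (N%:R * (s ^+ 2 * K)))).
    by apply: ler_sum => k _; case: (vP k).
  by rewrite sumr_const card_ord [leRHS]mulr_natl.
move=> w z z2 det0 /=; apply: nodeP z2 _; first exact: size_pencil.
by rewrite horner_pencil.
Qed.

End DiscEvent.

(** * Measurability of the absence of eigenvalues *)

Section Eigenvalues.
Context {R : realType}.

Lemma horner_char_poly N (A : 'M[R[i]]_N) z :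
  (char_poly A).[z] = (-1) ^+ N * \det (A - z%:M).
Proof.
rewrite -detZ scaleN1r opprB.
rewrite -horner_evalE -det_map_mx; congr (\det _).
apply/matrixP => i j; rewrite !mxE /= /horner_eval hornerD hornerN hornerC.
by rewrite hornerMn hornerX.
Qed.

Lemma char_poly_eigenvalues N (A : 'M[R[i]]_N) :
  char_poly A = \prod_(z <- eigenvalues A) ('X - z%:P).
Proof.
rewrite /eigenvalues; case: closed_field_poly_normal => r /= rE.
by rewrite {1}rE (monicP (char_poly_monic A)) scale1r.
Qed.

Lemma size_eigenvalues N (A : 'M[R[i]]_N) : size (eigenvalues A) = N.
Proof.
have := size_char_poly A; rewrite char_poly_eigenvalues size_prod_XsubC.
by case.
Qed.

Lemma mem_eigenvalues N (A : 'M[R[i]]_N) z :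
  (z \in eigenvalues A) = (\det (A - z%:M) == 0).
Proof.
rewrite -root_prod_XsubC -char_poly_eigenvalues /root horner_char_poly.
by rewrite mulf_eq0 signr_eq0.
Qed.

Lemma modulus_det_eigenvalues N (A : 'M[R[i]]_N) z :
  modulus (\det (A - z%:M)) = \prod_(l <- eigenvalues A) modulus (z - l).
Proof.
have -> : \det (A - z%:M) = (-1) ^+ N * (char_poly A).[z].
  by rewrite horner_char_poly mulrA -exprD -signr_odd addnn odd_double mul1r.
rewrite modulusM modulusX modulusN Normc.normc1 expr1n mul1r.
rewrite char_poly_eigenvalues horner_prod modulus_prod.
by apply: eq_bigr => l _; rewrite hornerXsubC.
Qed.

Lemma empirical_measure_eq0 N (A : 'M[R[i]]_N) (D : set R[i]) : (0 < N)%N ->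
  empirical_measure A D = 0 <-> forall z, \det (A - z%:M) = 0 -> ~ D z.
Proof.
move=> N0; rewrite /empirical_measure; split.
  move=> /eqP; rewrite mulf_eq0 invr_eq0 pnatr_eq0 eqn0Ngt N0 /=.
  rewrite psumr_eq0 => [/allP h z /eqP|l _]; last by rewrite indicE.
  rewrite -mem_eigenvalues => /h /=; rewrite indicE pnatr_eq0 eqb0 => /negP zD Dz.
  by apply: zD; exact: mem_set.
move=> h; rewrite big1_seq ?mulr0// => l /andP[_].
rewrite mem_eigenvalues indicE => /eqP /h lD.
by rewrite memNset.
Qed.

Lemma rat_dense (z : R[i]) (e : R) : 0 < e ->
  exists q : rat * rat, modulus ((ratr q.1 +i* ratr q.2) - z) <= e.
Proof.
case: z => a b e0.
have near_rat (x : R) : exists q : rat, `|ratr q - x| <= e / 2.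
  have [|q] := @rat_in_itvoo R (x - e / 2) (x + e / 2); first by lra.
  rewrite in_itv /= => /andP[h1 h2]; exists q.
  by rewrite ler_norml; lra.
have [q1 h1] := near_rat a; have [q2 h2] := near_rat b.
exists (q1, q2); rewrite (le_trans (modulus_le _))//=; lra.
Qed.

Lemma horner_bounded (g : {poly R[i]}) (c : R[i]) : exists2 G : R, 0 <= G &
  forall z, modulus (z - c) <= 1 -> modulus g.[z] <= G.
Proof.
exists (\sum_(i < size g) modulus g`_i * (modulus c + 1) ^+ i).
  by apply: sumr_ge0 => i _; rewrite mulr_ge0 ?exprn_ge0 ?addr_ge0 ?modulus_ge0.
move=> z zc; rewrite horner_coef (le_trans (modulus_sum _ _ _))//.
apply: ler_sum => i _; rewrite modulusM modulusX ler_wpM2l ?modulus_ge0//.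
rewrite lerXn2r ?nnegrE ?addr_ge0 ?modulus_ge0//.
by rewrite -[z](subrK c) addrC (le_trans (modulusD _ _))// lerD2l.
Qed.

Definition modulus_open (U : set R[i]) : Prop :=
  forall z, U z -> exists2 e : R, 0 < e & forall y, modulus (y - z) <= e -> U y.

Lemma expr_le_prod (r : seq R[i]) (F : R[i] -> R) (x : R) : 0 <= x ->
  (forall l, l \in r -> x <= F l) -> x ^+ size r <= \prod_(l <- r) F l.
Proof.
move=> x0; elim: r => [|l r IH] h; first by rewrite big_nil expr0.
rewrite big_cons /= exprS ler_pM ?exprn_ge0//.
  by apply: h; rewrite mem_head.
by apply: IH => k kr; apply: h; rewrite in_cons kr orbT.
Qed.

(** If z is at distance more than 1/(n + 1) from the N eigenvalues then
    |det(A - z)| >= (n + 1)^(-N). Conversely the determinant is arbitrarily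
    small near an eigenvalue. Both sides are thus compared at rational points
    only, with bounds which do not depend on [A]. *)
Lemma no_eigenvalueP N (A : 'M[R[i]]_N) (U : set R[i]) : modulus_open U ->
  (forall z, \det (A - z%:M) = 0 -> ~ U z) <->
  (forall (n : nat) (q : rat * rat), let z := ratr q.1 +i* ratr q.2 in
    (forall y, modulus (y - z) <= n.+1%:R^-1 -> U y) ->
    n.+1%:R^-1 ^+ N <= modulus (\det (A - z%:M))).
Proof.
move=> openU; split => [noU n q z zU | H c /eqP cE Uc].
  rewrite modulus_det_eigenvalues -{1}(size_eigenvalues A).
  apply: expr_le_prod => [|l]; first by rewrite invr_ge0.
  rewrite mem_eigenvalues => /eqP /noU lU.
  rewrite leNgt; apply/negP => zl; apply: lU; apply: zU.
  by rewrite -modulusN opprB ltW.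
have /factor_theorem[g gE] : root (char_poly A) c.
  by rewrite char_poly_eigenvalues root_prod_XsubC mem_eigenvalues.
have [e e0 eU] := openU _ Uc.
have [G G0 GP] := horner_bounded g c.
pose n := Num.truncn (2 / e).
have n2 : 2 / n.+1%:R <= e.
  rewrite ler_pdivrMr ?ltr0n// mulrC -ler_pdivrMr// ltW//.
  exact: truncnS_gt.
pose eta : R := n.+1%:R^-1 ^+ N.
have eta0 : 0 < eta by rewrite exprn_gt0// invr_gt0 ltr0n.
(* close enough to c for the disc around z to lie in U, and for the linear
   factor at c to make the determinant smaller than eta *)
pose delta := Num.min n.+1%:R^-1 (eta / (G + 1)).
have delta0 : 0 < delta.
  by rewrite lt_min invr_gt0 ltr0n/= divr_gt0// ltr_wpDl.
have [q qc] := rat_dense c delta0.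
set z := _ +i* _ in qc.
have z1 : modulus (z - c) <= n.+1%:R^-1 by rewrite (le_trans qc)// ge_min lexx.
have zeta : modulus (z - c) <= eta / (G + 1) by rewrite (le_trans qc)// ge_min lexx orbT.
have : eta <= modulus (\det (A - z%:M)).
  apply: H => y yz; apply: eU; apply: le_trans n2.
  rewrite -[y](subrK z) -addrA (le_trans (modulusD _ _))//.
  have {}yz : modulus (y - z) <= n.+1%:R^-1 by exact: yz.
  by rewrite mulr_natl mulr2n lerD.
rewrite modulus_det_eigenvalues.
have -> : \prod_(l <- eigenvalues A) modulus (z - l) = modulus (g.[z] * (z - c)).
  rewrite -hornerXsubC -hornerM -gE char_poly_eigenvalues horner_prod modulus_prod.
  by apply: eq_bigr => l _; rewrite hornerXsubC.
have zle1 : modulus (z - c) <= 1 by rewrite (le_trans z1)// invf_le1 ?ltr0n// ler1n.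
rewrite modulusM => h.
have h1 : modulus g.[z] * modulus (z - c) <= G * (eta / (G + 1)).
  by rewrite ler_pM ?modulus_ge0// GP.
have : G * (eta / (G + 1)) < eta.
  have G1 : 0 < G + 1 by rewrite ltr_wpDl.
  by rewrite mulrA ltr_pdivrMr// mulrC ltr_pM2l// ltrDl.
lra.
Qed.

Context {d : measure_display} {T : measurableType d}.

Lemma measurable_no_eigenvalue N (A : T -> 'M[R[i]]_N) (U : set R[i]) :
  modulus_open U -> (forall i j, complex_measurable (fun w => A w i j)) ->
  measurable [set w | forall z, \det (A w - z%:M) = 0 -> ~ U z].
Proof.
move=> openU mA.
pose pt (q : rat * rat) : R[i] := ratr q.1 +i* ratr q.2.
pose near_pt n q := forall y, modulus (y - pt q) <= n.+1%:R^-1 -> U y.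
(* rational points are enumerated through their codes in nat *)
pose F n k := [set w |
  if (choice.unpickle k : option (rat * rat)%type) is Some q then near_pt n q ->
   n.+1%:R^-1 ^+ N <= modulus (\det (A w - (pt q)%:M)) else True].
rewrite (_ : mkset _ = \bigcap_n \bigcap_k F n k); last first.
  apply/seteqP; split => w /=.
    move=> /(no_eigenvalueP _ openU) H n _ k _; rewrite /F /=.
    by case: (choice.unpickle k) => // q nq; exact: H.
  move=> H; apply/(no_eigenvalueP _ openU) => n q z zU.
  by have := H n I (choice.pickle q) I; rewrite /F /= choice.pickleK; apply.
apply: bigcapT_measurable => n; apply: bigcapT_measurable => k.
rewrite /F; case: (choice.unpickle k) => [q|]; last exact: measurableT.
have [nq|nq] := pselect (near_pt n q); last first.
  rewrite (_ : mkset _ = setT); first exact: measurableT.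
  by apply/seteqP; split => w //= _ /nq.
pose f w := msq (\det (A w - (pt q)%:M)).
have mf : measurable_fun [set: T] f.
  apply: measurable_msq; apply: complex_measurable_det => i j.
  under [X in complex_measurable X]eq_fun do rewrite mxE.
  by apply: complex_measurableD => //; exact: complex_measurable_cst.
rewrite (_ : mkset _ = f @^-1` `[(n.+1%:R^-1 ^+ N) ^+ 2, +oo[%classic).
  by rewrite -[X in measurable X]setTI; exact: mf.
have p0 : 0 <= n.+1%:R^-1 ^+ N :> R by rewrite exprn_ge0// invr_ge0.
apply/seteqP; split => w /=; rewrite in_itv /= andbT /f /msq.
  by move=> /(_ nq) h; rewrite lerXn2r ?nnegrE ?modulus_ge0.
by move=> h _; rewrite -(ler_pXn2r (n := 2)) ?nnegrE ?modulus_ge0.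
Qed.

End Eigenvalues.

(** * Covering the complement of the spectrum *)

Lemma powRN_cvg0 (R : realType) (b : R) : 0 < b ->
  (n%:R `^ (- b) : R) @[n --> \oo] --> (0 : R).
Proof.
move=> b0; apply/cvgrPdist_le => e e0.
exists (Num.truncn (e^-1 `^ b^-1)).+1 => // n /= en.
have n0 : (0 : R) < n%:R by rewrite ltr0n (leq_trans _ en).
rewrite sub0r normrN ger0_norm ?powR_ge0// powRN.
rewrite -[leRHS]invrK lef_pV2 ?posrE ?invr_gt0 ?powR_gt0//.
have le : e^-1 `^ b^-1 <= n%:R.
  by rewrite ltW// (lt_le_trans (truncnS_gt _))// ler_nat.
have bn : b != 0 by rewrite gt_eqF.
have ei : 0 <= e^-1 by rewrite invr_ge0 ltW.
have -> : e^-1 = (e^-1 `^ b^-1) `^ b by rewrite -powRrM mulVf// powRr1.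
by apply: ge0_ler_powR => //; rewrite ?nnegrE ?powR_ge0 ?ltW.
Qed.

(** For an empty [S] the infimum is +oo and the condition holds. *)
Lemma shrink_complP (R : realType) (S : set R[i]) (e : R) z :
  shrink (~` S) e z <->
  exists2 t : R, 0 < t & forall y, S y -> e + t <= modulus (z - y).
Proof.
rewrite /shrink /fatten setCK; split => /= [|[t t0 zS] Iz]; last first.
  suff : ((e + t)%:E <= e%:E)%E by rewrite lee_fin; lra.
  apply: le_trans Iz; apply: le_ereal_inf_tmp => _ [y Sy <-].
  by rewrite lee_fin zS.
move=> /negP; rewrite -ltNge; set I := ereal_inf _ => eI.
have [t t0 tI] : exists2 t : R, 0 < t & ((e + t)%:E <= I)%E.
  case: I eI => [r| |]//; first rewrite lte_fin => er.
    by exists (r - e); rewrite ?subr_gt0// addrC subrK.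
  by exists 1; rewrite ?ltr01// leey.
exists t => // y Sy; rewrite -lee_fin; apply: (le_trans tI).
by apply: ereal_inf_lbound; exists y.
Qed.

Lemma shrink_compl_open (R : realType) (S : set R[i]) (e : R) :
  modulus_open (shrink (~` S) e).
Proof.
move=> z /shrink_complP[t t0 zS]; exists (t / 2); first by rewrite divr_gt0.
move=> y yz; apply/shrink_complP; exists (t / 2); first by rewrite divr_gt0.
move=> x Sx; have := zS x Sx; have := modulusD (y - x) (z - y).
have -> : y - x + (z - y) = z - x by ring.
rewrite -(modulusN (z - y)) opprB; lra.
Qed.

(** Near covering along the filter generated by the finite sets of centres
    which contain a given finite set. *)
Lemma compact_finite_subcover (X : topologicalType) (A : set X)
    (f : X -> set X) : compact A -> (forall x, nbhs x (f x)) ->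
  exists Y : {fset X}, A `<=` \bigcup_(y in [set` Y]) f y.
Proof.
move=> /compact_near_coveringP cA fx.
pose F : set_system {fset X} :=
  [set S | exists Y0 : {fset X}, forall Y : {fset X}, {subset Y0 <= Y} -> S Y].
have FF : Filter F.
  split; first by exists fset0.
    move=> S S' [Y0 h] [Y1 h']; exists (Y0 `|` Y1)%fset => Y YY; split.
      by apply: h => y yY; apply: YY; rewrite in_fsetU yY.
    by apply: h' => y yY; apply: YY; rewrite in_fsetU yY orbT.
  by move=> S S' SS' [Y0 h]; exists Y0 => Y /h /SS'.
have [|Y0 h] := cA _ F (fun Y x => (\bigcup_(y in [set` Y]) f y) x) FF.
  move=> x Ax; exists (f x, [set Y : {fset X} | x \in Y]) => /=.
    split; first exact: fx.
    by exists [fset x]%fset => Y; apply; rewrite inE.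
  by move=> [y Y] /= [fy xY]; exists x.
by exists Y0; exact: h.
Qed.

Section Outliers.
Context {R : realType}.
Variables (d1 d2 : nat) (a : int -> R[i]) (gamma : R).
Hypothesis hgamma : 2^-1 < gamma.
Variables (disp : nat -> measure_display)
  (Omega : forall N : nat, measurableType (disp N))
  (P : forall N : nat, probability (Omega N) R)
  (E : forall N : nat, Omega N -> 'M[R[i]]_N).
Hypothesis hE : forall N : nat, random_matrix_hyp (P N) (@E N).

Let scale N : R := N%:R `^ (- gamma).
Let rate N : R := N%:R * scale N ^+ 2.
Let perturbed N w := toeplitz_mx d1 d2 a N + (scale N)%:C *: E w.

Lemma rate_ge0 N : 0 <= rate N.
Proof. by rewrite mulr_ge0// sqr_ge0. Qed.

Lemma rate_cvg0 : rate N @[N --> \oo] --> (0 : R).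
Proof.
have b0 : 0 < 2 * gamma - 1 by move: hgamma; lra.
apply: cvg_trans (powRN_cvg0 b0); apply: near_eq_cvg.
exists 1%N => // N /= N0; have NR : (N%:R : R) != 0 by rewrite pnatr_eq0 -lt0n.
rewrite /rate /scale -powR_mulrn ?powR_ge0// -powRrM -[X in _ = X * _]powRr1//.
by rewrite -powRD ?NR ?implybT//; congr (_ `^ _); ring.
Qed.

Lemma rate_small (K : R) : 0 < K -> \forall N \near \oo, rate N * K <= 2^-1.
Proof.
move=> K0; have e0 : 0 < (2 * K)^-1 by rewrite invr_gt0 mulr_gt0.
have /cvgrPdist_le/(_ _ e0) := rate_cvg0; apply: filterS => N.
rewrite sub0r normrN ger0_norm ?rate_ge0// => h.
rewrite (le_trans (ler_wpM2r (ltW K0) h))// invfM -mulrA mulVf ?gt_eqF//.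
by rewrite mulr1.
Qed.

(** Eigenvalues in [D] can only occur on an exceptional event of probability
    O(N^(1 - 2 gamma)). *)
Definition controlled (D : set R[i]) : Prop :=
  exists2 K : R, 0 <= K & \forall N \near \oo, exists A : set (Omega N),
    [/\ measurable A, (P N A <= (K * rate N)%:E)%E &
        forall w z, D z -> \det (perturbed w - z%:M) = 0 -> A w].

Lemma controlledS (D D' : set R[i]) : D `<=` D' -> controlled D' -> controlled D.
Proof.
move=> DD' [K K0 H]; exists K => //; apply: filterS H => N [A [mA PA AD]].
by exists A; split => // w z /DD'; exact: AD.
Qed.

Lemma controlled0 : controlled set0.
Proof.
exists 0 => //; apply: nearW => N; exists set0; split => //.
by rewrite measure0 mul0r.
Qed.

Lemma controlledU (D D' : set R[i]) :
  controlled D -> controlled D' -> controlled (D `|` D').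
Proof.
move=> [K K0 H] [K' K'0 H']; exists (K + K'); first exact: addr_ge0.
apply: filterS2 H H' => N [A [mA PA AD]] [A' [mA' PA' AD']].
exists (A `|` A'); split.
- exact: measurableU.
- apply: (le_trans (measureU2 _ mA mA')).
  by rewrite mulrDl EFinD leeD.
- by move=> w z [Dz|Dz] z0; [left; exact: AD z0|right; exact: AD' z0].
Qed.

Lemma controlled_bigcup (I : choiceType) (Y : {fset I}) (D : I -> set R[i]) :
  (forall y, controlled (D y)) -> controlled (\bigcup_(y in [set` Y]) D y).
Proof.
move=> HD; suff H (s : seq I) : controlled [set z | exists2 y, y \in s & D y z].
  by apply: controlledS (H Y) => z [y yY Dz]; exists y.
elim: s => [|y s IH].
  by apply: controlledS controlled0 => z [].
apply: controlledS (controlledU (HD y) IH) => z [x].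
rewrite in_cons => /predU1P[->|xs] Dz; first by left.
by right; exists x.
Qed.

Lemma controlled_disc c : ~ l2_spectrum (toeplitz_op d1 d2 a) c ->
  exists2 r : R, 0 < r & controlled [set z | modulus (z - c) <= r].
Proof.
move=> /toeplitz_mx_stable_disc[r [C [r0 C0 stab]]].
exists (r / 2); first by rewrite divr_gt0.
exists (72 * C); first by rewrite mulr_ge0// ltW.
have rC : (r%:C : R[i]) != 0 by rewrite -modulus_eq0 modulus_real normr_eq0 gt_eqF.
apply: filterS2 stab (rate_small C0) => N stab small.
have lb u : modulus u <= 1 -> lower_bounded C
    (toeplitz_mx d1 d2 a N - c%:M + u *: (- (r%:C%:M))).
  move=> u1; have -> : toeplitz_mx d1 d2 a N - c%:M + u *: (- r%:C%:M) =
      toeplitz_mx d1 d2 a N - (c + u * r%:C)%:M.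
    by rewrite scalerN scale_scalar_mx raddfD /= opprD addrA.
  apply: stab; rewrite addrAC subrr add0r modulusM modulus_real gtr0_norm//.
  by rewrite ler_piMl// ltW.
have v1 u : modulus u <= 1 -> modulus (1 + u * 0 : R[i]) <= 1.
  by move=> _; rewrite mulr0 addr0 Normc.normc1.
have small' : N%:R * (scale N ^+ 2 * C) <= 2^-1 by rewrite mulrA.
have [A [mA PA AP]] := disc_event (hE N) C0 lb v1 small'.
exists A; split => //; first by rewrite /rate -mulrA [C * _]mulrC -mulrA.
move=> w z /= zc z0; apply: (AP w ((z - c) / r%:C)).
  rewrite modulusM modulusV modulus_real gtr0_norm// ler_pdivrMr//.
  by rewrite mulrC.
rewrite -[RHS]z0; congr (\det _); apply/matrixP => i j; rewrite /perturbed !mxE.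
by case: (i == j); rewrite ?mulr1n ?mulr0n; field.
Qed.

Lemma controlled_infinity : exists2 L : R, 0 < L &
  controlled [set z | L <= modulus z].
Proof.
have [r r0 stab] := toeplitz_mx_stable_infinity d1 d2 a.
exists (2 * r); first by rewrite mulr_gt0.
exists 72; first by [].
apply: filterS (rate_small (ltr01 : 0 < 1 :> R)) => N small.
have rC : (r%:C : R[i]) != 0 by rewrite -modulus_eq0 modulus_real normr_eq0 gt_eqF.
have lb u : modulus u <= 1 -> lower_bounded 1
    (- (r%:C%:M) + u *: toeplitz_mx d1 d2 a N).
  by move=> u1; rewrite addrC; exact: stab.
have v1 u : modulus u <= 1 -> modulus (0 + u * 1 : R[i]) <= 1.
  by rewrite mulr1 add0r.
have small' : N%:R * (scale N ^+ 2 * 1) <= 2^-1 by rewrite mulrA.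
have [A [mA PA AP]] := disc_event (hE N) ltr01 lb v1 small'.
exists A; split => //; first by rewrite /rate -[scale N ^+ 2]mulr1.
move=> w z /= zr z0.
have mz : 0 < modulus z by rewrite (lt_le_trans _ zr)// mulr_gt0.
have zn0 : z != 0 by rewrite -modulus_eq0 gt_eqF.
apply: (AP w (r%:C / z)).
  rewrite modulusM modulusV modulus_real gtr0_norm// ler_pdivrMr//.
  by rewrite ler_pdivlMl.
rewrite scale0r addr0 scale1r.
have -> : - r%:C%:M + (r%:C / z) *: (toeplitz_mx d1 d2 a N + (scale N)%:C *: E w) =
   (r%:C / z) *: (perturbed w - z%:M).
  by rewrite scalerBr scale_scalar_mx divfK// addrC.
by rewrite detZ z0 mulr0.
Qed.

(** Every point of the plane is the centre of a disc where the shrunken set is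
    controlled: around a point of the spectrum the disc of radius eps does not
    meet that set. Finitely many discs cover a large square, and the rest of the
    plane is a neighbourhood of infinity. *)
Lemma controlled_outside (eps : R) : 0 < eps ->
  controlled (shrink (~` l2_spectrum (toeplitz_op d1 d2 a)) eps).
Proof.
move=> e0; set S := l2_spectrum _; set U := shrink _ _.
have [L L0 cL] := controlled_infinity.
have /choice[r rP] (y : R * R) : exists r : R, 0 < r /\
    controlled (U `&` [set z | modulus (z - (y.1 +i* y.2)) <= r]).
  have [Sy|Sy] := pselect (S (y.1 +i* y.2)).
    exists eps; split => //; apply: controlledS controlled0 => z [Uz /= zy].
    have /shrink_complP[t t0 /(_ _ Sy)] := Uz; lra.
  have [r r0 cr] := controlled_disc Sy; exists r; split => //.
  by apply: controlledS cr => z [].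
pose box : set (R * R) := `[- L, L]%classic `*` `[- L, L]%classic.
have cbox : compact box by apply: compact_setX; exact: segment_compact.
have [y|Y boxY] := compact_finite_subcover cbox (f := fun y => ball y (r y / 2)).
  by apply: nbhsx_ballx; rewrite divr_gt0//; case: (rP y).
apply: controlledS (controlledU cL (controlled_bigcup Y (fun y => (rP y).2))) => z Uz.
have [Lz|zL] := leP L (modulus z); first by left.
right; case: (boxY (complex.Re z, complex.Im z)).
  split; rewrite /= in_itv /= -ler_norml.
    exact: le_trans (Re_le_modulus z) (ltW zL).
  exact: le_trans (Im_le_modulus z) (ltW zL).
move=> y yY [/= h1 h2]; exists y => //; split => //=.
apply: (le_trans (modulus_le _)); case: z h1 h2 {Uz zL} => p q /=.
rewrite /ball /= => h1 h2; rewrite -normrN opprB -[X in _ + X]normrN opprB; lra.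
Qed.

Lemma perturbed_measurable N i j :
  complex_measurable (fun w : Omega N => perturbed w i j).
Proof.
rewrite /perturbed; under [X in complex_measurable X]eq_fun do rewrite mxE [X in _ + X]mxE.
apply: complex_measurableD; first exact: complex_measurable_cst.
apply: complex_measurableM; first exact: complex_measurable_cst.
by case: (hE N) => mE _ _ _; apply: complex_rvP; exact: (mE (i, j)).
Qed.

(** Measurability of the event is what allows its probability to be bounded
    below by that of the complement of an exceptional event. *)
Lemma probability_no_eigenvalue (U : set R[i]) : modulus_open U -> controlled U ->
  P N [set w : Omega N | empirical_measure (perturbed w) U = 0] @[N --> \oo]
    --> (1%E : \bar R).
Proof.
move=> openU [K K0 H].
apply: (@squeeze_cvge _ _ _ _ (fun N => (1 - K * rate N)%:E) _ (fun=> 1%E)); last 2 first.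
- apply: cvg_EFin; first exact: nearW.
  rewrite -[X in _ --> X]subr0; apply: cvgB; first exact: cvg_cst.
  by rewrite -(mulr0 K); apply: cvgMl_tmp; exact: rate_cvg0.
- exact: cvg_cst.
apply: filterS2 H (nbhs_infty_gt 0) => N [A [mA PA AU]] /= N0.
have -> : [set w | empirical_measure (perturbed w) U = 0] =
    [set w : Omega N | forall z, \det (perturbed w - z%:M) = 0 -> ~ U z].
  by apply/seteqP; split => w /=; move/(empirical_measure_eq0 _ _ N0).
set G := mkset _.
have mG : measurable G.
  by apply: measurable_no_eigenvalue => // i j; exact: perturbed_measurable.
rewrite probability_le1// andbT.
have : (P N (~` A) <= P N G)%E.
  apply: le_measure; first by apply: mem_set; exact: measurableC.
    exact: mem_set.
  by move=> w nA z z0 Uz; apply: nA; exact: AU Uz z0.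
apply: le_trans; rewrite probability_setC// EFinB; apply: leeB => //.
Qed.

End Outliers.

Theorem theorem1p1 (R : realType) (d1 d2 : nat) (a : int -> R[i])
    (hd1 : (1 <= d1)%N) (ha : a d1%:Z != 0)
    (gamma : R) (hgamma : 2^-1 < gamma)
    (disp : nat -> measure_display)
    (Omega : forall N : nat, measurableType (disp N))
    (P : forall N : nat, probability (Omega N) R)
    (E : forall N : nat, Omega N -> 'M[R[i]]_N)
    (hE : forall N : nat, random_matrix_hyp (P N) (@E N))
    (eps : R) (heps : 0 < eps) :
  P N [set w | empirical_measure
                 (toeplitz_mx d1 d2 a N + (N%:R `^ (- gamma))%:C *: E N w)
                 (shrink (~` l2_spectrum (toeplitz_op d1 d2 a)) eps) = 0]
    @[N --> \oo] --> (1%E : \bar R).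
Proof.
apply: probability_no_eigenvalue => //; first exact: shrink_compl_open.
exact: controlled_outside.
Qed.
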